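(* Let $Q$ be an acyclic quiver with vertex set $Q_0$ and set of $c$-vectors $C(Q)\subset\mathbb{Z}^{Q_0}$. If $Q$ is of finite type, then $C(Q)$ is finite, so every coordinate difference $c_v-c_w$ ($v,w\in Q_0$) is bounded over $c\in C(Q)$. If $Q$ is of affine type with null root $\delta$, then for $v,w\in Q_0$, $$\sup_{c\in C(Q)}|c_v-c_w|<\infty\quad\Longleftrightarrow\quad \delta_v=\delta_w,$$ and when $\delta_v=\delta_w$ one has $$b_{vw}:=\sup_{c\in C(Q)}|c_v-c_w|=\max_{\alpha\in\Delta_{\mathrm{fin}}}|\alpha_v-\alpha_w|,$$ where $\Delta_{\mathrm{fin}}$ is the set of (real) roots of the underlying finite root system.
   Context: All quivers are finite, connected, and without loops or 2-cycles. $C(Q)\subset\mathbb{Z}^{Q_0}$ denotes the set of all $c$-vectors (columns of the $c$-matrices of all seeds) of the cluster algebra with principal coefficients at the seed associated with the acyclic quiver $Q$. It is known that $C(Q)=\{\pm\beta:\beta\text{ a real Schur root of }Q\}$, where the real Schur roots are the dimension vectors of the exceptional (rigid, indecomposable) $kQ$-modules, $k$ algebraically closed. $Q$ is of finite (resp. affine) type if its underlying graph is a Dynkin (resp. Euclidean, i.e. extended Dynkin) diagram. In affine type, the null root $\delta$ is the positive primitive generator of the radical of the (positive semidefinite) Tits form $q(x)=\sum_i x_i^2-\sum_{i\to j}x_ix_j$. The underlying finite root system $\Delta_{\mathrm{fin}}\subset\mathbb{Z}^{Q_0}$ is the root system of the Dynkin diagram obtained by deleting an extending vertex $v_0$ (one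 with $\delta_{v_0}=1$), its roots being regarded as vectors of $\mathbb{Z}^{Q_0}$ that vanish at $v_0$; the real roots of $Q$ are exactly $\alpha+m\delta$ with $\alpha\in\Delta_{\mathrm{fin}}$, $m\in\mathbb{Z}$. *)

(* Defs.v *)
From mathcomp Require Import all_boot all_order all_algebra.
From mathcomp Require Import perm classical_sets functions cardinality.

Set Implicit Arguments.
Unset Strict Implicit.
Unset Printing Implicit Defensive.

Import Order.TTheory GRing.Theory Num.Theory.

Local Open Scope ring_scope.
Local Open Scope classical_set_scope.

(* [arrows i j] is the number of arrows i -> j. *)
Record quiver (n : nat) := Quiver {
  arrows :> 'I_n -> 'I_n -> nat;
  quiver_no_loop : forall i, arrows i i = 0%N;
  quiver_no_2cycle : forall i j, arrows i j = 0%N \/ arrows j i = 0%N;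
  quiver_connected :
    forall i j, connect (fun x y => 0 < arrows x y + arrows y x)%N i j
}.

Definition acyclic n (Q : quiver n) : Prop :=
  forall s : seq 'I_n, s != [::] -> ~~ cycle (fun i j => 0 < Q i j)%N s.

(* A finite multigraph is given by its number of vertices (which are
   0, 1, 2, ...) and the list of its edges, with repetitions. *)
Definition edge_mult (es : seq (nat * nat)) (a b : nat) : nat :=
  (count_mem (a, b) es + count_mem (b, a) es)%N.

Definition underlying_graph_is n (Q : quiver n) (es : seq (nat * nat)) : Prop :=
  exists s : {perm 'I_n}, forall i j : 'I_n,
    (Q i j + Q j i)%N = edge_mult es (s i) (s j).

(* The path 0 - 1 - ... - (k - 1) on k vertices. *)
Definition path_edges (k : nat) : seq (nat * nat) :=
  [seq (i, i.+1) | i <- iota 0 k.-1].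

(* [dynkin n es]: es is a connected simply-laced Dynkin diagram with n
   vertices. *)
Inductive dynkin : nat -> seq (nat * nat) -> Prop :=
| DynkinA n of (1 <= n)%N : dynkin n (path_edges n)
| DynkinD n of (4 <= n)%N :
    dynkin n (rcons (path_edges n.-1) (n - 3, n.-1)%N)
| DynkinE n of (6 <= n <= 8)%N :
    dynkin n (rcons (path_edges n.-1) (2, n.-1)%N).

(* [euclidean n es]: same for the extended diagrams; the one usually indexed
   by m has m + 1 vertices.  The cycle on 2 vertices is the Kronecker graph,
   with a double edge. *)
Inductive euclidean : nat -> seq (nat * nat) -> Prop :=
| EuclideanA m of (1 <= m)%N :
    euclidean m.+1 (rcons (path_edges m.+1) (m, 0)%N)
| EuclideanD m of (4 <= m)%N :
    euclidean m.+1 (path_edges m.-1 ++ [:: (1, m.-1); (m - 3, m)])%N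
| EuclideanE6 : euclidean 7 (path_edges 5 ++ [:: (2, 5); (5, 6)])%N
| EuclideanE7 : euclidean 8 (path_edges 7 ++ [:: (3, 7)])%N
| EuclideanE8 : euclidean 9 (path_edges 8 ++ [:: (2, 8)])%N.

Definition finite_type n (Q : quiver n) : Prop :=
  exists2 es, dynkin n es & underlying_graph_is Q es.

Definition affine_type n (Q : quiver n) : Prop :=
  exists2 es, euclidean n es & underlying_graph_is Q es.

Definition exchange_matrix n (Q : quiver n) : 'M[int]_n :=
  \matrix_(i, j) ((Q i j)%:Z - (Q j i)%:Z).

(* Fomin-Zelevinsky matrix mutation, for an extended exchange matrix whose
   last m rows are frozen. *)
Definition mutate n m (B : 'M[int]_(n + m, n)) (k : 'I_n) :
    'M[int]_(n + m, n) :=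
  \matrix_(i, j)
    if (i == lshift m k) || (j == k) then - B i j
    else B i j + Num.sg (B i k) * Num.max 0 (B i k * B (lshift m k) j).

(* The extended exchange matrix of the seed obtained from the initial seed,
   with principal coefficients, by mutating successively at the vertices ks.
   The cluster variables play no role in the mutation of matrices, so that
   every seed gives, and is only recorded through, such a matrix. *)
Definition seed_matrix n (Q : quiver n) (ks : seq 'I_n) : 'M[int]_(n + n, n) :=
  foldl (@mutate n n) (col_mx (exchange_matrix Q) 1%:M) ks.

Definition c_matrix n (Q : quiver n) (ks : seq 'I_n) : 'M[int]_n :=
  dsubmx (seed_matrix Q ks).

Definition c_vectors n (Q : quiver n) : set 'cV[int]_n :=
  [set c | exists ks : seq 'I_n, exists j : 'I_n, c = col j (c_matrix Q ks)].

Definition tits_form n (Q : quiver n) (x : 'cV[int]_n) : int :=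
  \sum_i x i 0 ^+ 2 - \sum_i \sum_j (x i 0 * x j 0) *+ Q i j.

Definition tits_bilin n (Q : quiver n) (x y : 'cV[int]_n) : int :=
  tits_form Q (x + y) - tits_form Q x - tits_form Q y.

Definition tits_radical n (Q : quiver n) : set 'cV[int]_n :=
  [set x | forall y, tits_bilin Q x y = 0].

(* A generator over int of the radical is automatically primitive, since the
   radical is a saturated subgroup. *)
Definition null_root n (Q : quiver n) (d : 'cV[int]_n) : Prop :=
  [/\ d != 0, forall i, 0 <= d i 0
    & tits_radical Q = [set x | exists m : int, x = m *: d]].

Definition simple_root n (i : 'I_n) : 'cV[int]_n := delta_mx i 0.

Definition reflection n (Q : quiver n) (i : 'I_n) (x : 'cV[int]_n) :
    'cV[int]_n :=
  x - tits_bilin Q x (simple_root i) *: simple_root i.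

(* The orbit of the simple roots under the Weyl group of the diagram with the
   vertex v0 deleted.  On vectors vanishing at v0, the Tits form of Q is the
   one of the full subquiver on the other vertices. *)
Inductive fin_root n (Q : quiver n) (v0 : 'I_n) : set 'cV[int]_n :=
| FinRootSimple i of i != v0 : fin_root Q v0 (simple_root i)
| FinRootReflection i x of i != v0 & fin_root Q v0 x :
    fin_root Q v0 (reflection Q i x).

Definition coord_diffs n (X : set 'cV[int]_n) (v w : 'I_n) : set int :=
  [set `|x v 0 - x w 0| | x in X].

Definition is_max (A : set int) (b : int) : Prop := A b /\ ubound A b.

(* Main.v *)
(* Let E be the Euler form of Q and q(x) = E(x, x).  Along every mutation sequence the
   c-vectors form a basis of sign-coherent vectors with q = 1 such that E(c, c') = 0 for c
   positive and c' negative, and E(c, c') <= 0 for c <> c' of the same sign.  A mutation could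
   only break this by producing a certain configuration of four positive roots (the trace, on
   dimension vectors, of a violation of heredity).  Such a configuration never contains the
   sink or the source of a simple system, hence it stays positive under all source and sink
   reflections, that is under all powers of the Coxeter transformation.  As the q = 1 vectors
   are finitely many modulo the null root, this is absurd in a positive definite span and
   forces regular roots in affine type; a non-regular root perpendicular to the configuration
   then becomes a sink or a source, and removing it leaves a positive definite span.

   Conversely, mutating at a positive sink of the c-vectors reflects the whole simple system
   and turns exactly one positive root, itself a c-vector, into a negative one.  Hence if there
   are finitely many c-vectors, all positive roots are c-vectors.  Applied to Q minus v0 this
   gives the finite roots, and in affine type it shows that there are infinitely many
   c-vectors, finitely many modulo the null root d.  So c_v - c_w is bounded exactly when
   d_v = d_w, and then it only depends on the class of c modulo d, that is on a finite root. *)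

Require Import Defs.
From mathcomp Require Import all_boot all_order all_algebra.
From mathcomp Require Import classical_sets functions cardinality.
From mathcomp Require Import perm boolp zify ring.

Set Implicit Arguments.
Unset Strict Implicit.
Unset Printing Implicit Defensive.

(** * Bilinear forms, reflections and simple systems *)

Section Forms.
Import Order.TTheory GRing.Theory Num.Theory.
Local Open Scope ring_scope.

Variable n : nat.
Notation V := 'cV[int]_n.
Implicit Types (M : 'M[int]_n) (x y z c : V) (b : 'I_n -> V) (l : seq 'I_n).

Definition bform M x y : int := (x^T *m M *m y) 0 0.
Definition sform M x y : int := bform M x y + bform M y x.
Definition refl M c x : V := x - sform M x c *: c.
Definition radical M x := forall z, sform M x z = 0.
Definition psd M := forall x, 0 <= bform M x x.

Lemma bform_tr M x y : bform M^T x y = bform M y x.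
Proof.
rewrite /bform; transitivity ((x^T *m M^T *m y)^T 0 0); first by rewrite [RHS]mxE.
by rewrite !trmx_mul !trmxK mulmxA.
Qed.

Lemma bformDl M x y z : bform M (x + y) z = bform M x z + bform M y z.
Proof. by rewrite /bform linearD /= !mulmxDl mxE. Qed.
Lemma bformDr M x y z : bform M z (x + y) = bform M z x + bform M z y.
Proof. by rewrite /bform mulmxDr mxE. Qed.
Lemma bformZl M a x z : bform M (a *: x) z = a * bform M x z.
Proof. by rewrite /bform linearZ /= -!scalemxAl mxE. Qed.
Lemma bformZr M a x z : bform M z (a *: x) = a * bform M z x.
Proof. by rewrite /bform -scalemxAr mxE. Qed.
Lemma bformNl M x z : bform M (- x) z = - bform M x z.
Proof. by rewrite -scaleN1r bformZl mulN1r. Qed.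
Lemma bformNr M x z : bform M z (- x) = - bform M z x.
Proof. by rewrite -scaleN1r bformZr mulN1r. Qed.
Lemma bform0l M z : bform M 0 z = 0.
Proof. by rewrite -(scale0r z) bformZl mul0r. Qed.
Lemma bform0r M z : bform M z 0 = 0.
Proof. by rewrite -(scale0r z) bformZr mul0r. Qed.
Definition bformE := (bformDl, bformDr, bformNl, bformNr, bformZl, bformZr).

Lemma bform_suml M I (r : seq I) (P : pred I) (F : I -> V) z :
  bform M (\sum_(i <- r | P i) F i) z = \sum_(i <- r | P i) bform M (F i) z.
Proof. by apply: (big_morph (fun x => bform M x z)) => [x y|]; rewrite ?bformDl ?bform0l. Qed.
Lemma bform_sumr M I (r : seq I) (P : pred I) (F : I -> V) z :
  bform M z (\sum_(i <- r | P i) F i) = \sum_(i <- r | P i) bform M z (F i).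
Proof. by apply: (big_morph (bform M z)) => [x y|]; rewrite ?bformDr ?bform0r. Qed.

Lemma sform_tr M x y : sform M^T x y = sform M x y.
Proof. by rewrite /sform !bform_tr addrC. Qed.
Lemma refl_tr M c x : refl M^T c x = refl M c x.
Proof. by rewrite /refl sform_tr. Qed.

Lemma isotropic_rad M x : psd M -> bform M x x = 0 -> radical M x.
Proof.
move=> Mpsd x0 z; rewrite /sform.
set s := _ + _; set t := bform M z z.
have H k : 0 <= k * s + t.
  have := Mpsd (k *: x + z); rewrite !bformE x0 /s /t; nia.
(* At k = -s(t + 1) the affine function k s + t equals t - s^2 (t + 1), which is negative unless s =
   0. *)
by have := H (- s * (t + 1)); have := H 0; nia.
Qed.

Lemma reflK M c : bform M c c = 1 -> involutive (refl M c).
Proof.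
move=> c1 x; rewrite /refl /sform !bformE c1.
by apply/colP => i; rewrite !mxE; ring.
Qed.

Lemma sform_refl M c x y : bform M c c = 1 ->
  sform M (refl M c x) (refl M c y) = sform M x y.
Proof. by move=> c1; rewrite /refl /sform !bformE c1; ring. Qed.

Lemma sform_norm M x : sform M x x = 2 * bform M x x.
Proof. by rewrite /sform; ring. Qed.

Lemma bform_refl M c x : bform M c c = 1 ->
  bform M (refl M c x) (refl M c x) = bform M x x.
Proof. by move=> c1; have := sform_refl x x c1; rewrite !sform_norm; lia. Qed.

Lemma reflD M c : {morph refl M c : x y / x + y}.
Proof.
move=> x y; rewrite /refl /sform !bformE.
by apply/colP => i; rewrite !mxE; ring.
Qed.
Lemma reflZ M c a : {morph refl M c : x / a *: x}.
Proof.
move=> x; rewrite /refl /sform !bformE.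
by apply/colP => i; rewrite !mxE; ring.
Qed.
Lemma refl_self M c : bform M c c = 1 -> refl M c c = - c.
Proof.
move=> c1; rewrite /refl /sform c1.
by apply/colP => i; rewrite !mxE; ring.
Qed.
Lemma reflN M c x : refl M (- c) x = refl M c x.
Proof. by rewrite /refl /sform !bformE -opprD scalerN scaleNr opprK. Qed.
Lemma refl_rad M c x : radical M x -> refl M c x = x.
Proof. by move=> xr; rewrite /refl xr scale0r subr0. Qed.

Definition lincomb b l (f : 'I_n -> int) : V := \sum_(i <- l) f i *: b i.
Definition in_cone b l x := exists2 f : 'I_n -> int, (forall i, 0 <= f i) & x = lincomb b l f.

Definition isom M (s : V -> V) :=
  [/\ {morph s : x y / x + y}, forall a, {morph s : x / a *: x},
      forall x y, sform M (s x) (s y) = sform M x y & forall x, radical M x -> s x = x].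

Lemma isom_refl M c : bform M c c = 1 -> isom M (refl M c).
Proof.
move=> c1; split; [exact: reflD|exact: reflZ|by move=> *; apply: sform_refl|].
by move=> x; apply: refl_rad.
Qed.
Lemma isom_id M : isom M id. Proof. by []. Qed.
Lemma isom_comp M s t : isom M s -> isom M t -> isom M (s \o t).
Proof.
case=> sD sZ sS sr [tD tZ tS tr]; split => /= [x y|a x|x y|x xr].
- by rewrite /= tD sD.
- by rewrite /= tZ sZ.
- by rewrite sS tS.
- by rewrite tr ?sr.
Qed.
Lemma isom_iter M s k : isom M s -> isom M (iter k s).
Proof.
move=> si; elim: k => [|k IH]; first exact: isom_id.
by have := isom_comp si IH.
Qed.
Lemma isom0 M s : isom M s -> s 0 = 0.
Proof. by case=> _ sZ _ _; rewrite -(scale0r 0) sZ !scale0r. Qed.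
Lemma isom_norm M s x : isom M s -> bform M (s x) (s x) = bform M x x.
Proof. by case=> _ _ sS _; have := sS x x; rewrite !sform_norm; lia. Qed.

Lemma isom_refl_conj M s c x : isom M s -> refl M (s c) (s x) = s (refl M c x).
Proof. by case=> sD sZ sS _; rewrite /refl sS -!scaleNr sD sZ. Qed.

Lemma isom_lincomb M s b l f : isom M s -> s (lincomb b l f) = lincomb (s \o b) l f.
Proof.
move=> si; have s0 := isom0 si; case: si => sD sZ _ _.
rewrite /lincomb (big_morph s sD s0).
by apply: eq_bigr => i _; rewrite sZ.
Qed.

Lemma lincomb_perm b l l' f : perm_eq l l' -> lincomb b l f = lincomb b l' f.
Proof. exact: perm_big. Qed.
Lemma in_cone_perm b l l' x : perm_eq l l' -> in_cone b l x -> in_cone b l' x.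
Proof. by move=> e [f f0 ->]; exists f => //; apply: lincomb_perm. Qed.
Lemma lincombD b l f g : lincomb b l (fun i => f i + g i) = lincomb b l f + lincomb b l g.
Proof. by rewrite /lincomb -big_split; apply: eq_bigr => i _; rewrite scalerDl. Qed.
Lemma lincombN b l f : lincomb b l (fun i => - f i) = - lincomb b l f.
Proof. by rewrite /lincomb -sumrN; apply: eq_bigr => i _; rewrite scaleNr. Qed.
Lemma eq_lincomb b l f g : {in l, f =1 g} -> lincomb b l f = lincomb b l g.
Proof. by move=> e; apply: eq_big_seq => i il; rewrite e. Qed.
(** The last field makes the span of any proper subset anisotropic, as for the simple roots of a
    Euclidean diagram, whose null root has full support. *)
Record simple_system M b l : Prop := Simple {
  simple_uniq : uniq l;
  simple_norm : forall i, i \in l -> bform M (b i) (b i) = 1;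
  simple_le : forall i j, i \in l -> j \in l -> i != j -> bform M (b i) (b j) <= 0;
  simple_proper : forall f i, i \in l -> f i = 0 ->
    bform M (lincomb b l f) (lincomb b l f) = 0 -> lincomb b l f = 0 }.

Lemma simple_tr M b l : simple_system M b l -> simple_system M^T b l.
Proof.
case=> U N L P; split=> // [i il|i j il jl ij|f i il fi].
- by rewrite bform_tr N.
- by rewrite bform_tr L // eq_sym.
- by rewrite bform_tr; apply: P fi.
Qed.

Lemma simple_perm M b l l' : perm_eq l l' -> simple_system M b l -> simple_system M b l'.
Proof.
move=> e [U N L P]; split.
- by rewrite -(perm_uniq e).
- by move=> i; rewrite -(perm_mem e); apply: N.
- by move=> i j; rewrite -!(perm_mem e); apply: L.
- by move=> f i; rewrite -(perm_mem e) -(lincomb_perm b f e); apply: P.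
Qed.

Lemma lincomb_split b l f k : uniq l -> k \in l ->
  lincomb b l f = lincomb b l (fun i => if i == k then 0 else f i) + f k *: b k.
Proof.
move=> U kl; rewrite /lincomb !(bigD1_seq k kl U) /= eqxx scale0r add0r addrC.
by congr (_ + _); apply: eq_bigr => i /negbTE ->.
Qed.

Lemma simple_system_le M b l f k : simple_system M b l -> k \in l -> (forall i, 0 <= f i) -> f k = 0 ->
  bform M (lincomb b l f) (b k) <= 0.
Proof.
move=> S kl f0 fk; rewrite /lincomb bform_suml big_seq; apply: sumr_le0 => i il.
rewrite bformZl; have [->|ik] := eqVneq i k; first by rewrite fk mul0r.
by rewrite mulr_ge0_le0 // (simple_le S).
Qed.

(** A simple reflection keeps all other positive roots positive. Write x = y + f_k b_k and s_k x = y
    + m b_k with y free of b_k. If m < 0, then q(s_k x) = 1 forces q(y) = 0, hence y = 0 and x =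
    b_k. *)
Lemma in_cone_refl M b l k x : psd M -> simple_system M b l -> k \in l -> bform M x x = 1 ->
  in_cone b l x -> x <> b k -> in_cone (refl M (b k) \o b) l x.
Proof.
move=> Mpsd S kl x1 [f f0 xE] xk.
have k1 := simple_norm S kl.
set f' := fun i => if i == k then 0 else f i.
have f'0 i : 0 <= f' i by rewrite /f'; case: ifP.
have f'k : f' k = 0 by rewrite /f' eqxx.
have := lincomb_split b f (simple_uniq S) kl; rewrite -xE -/f' => xS.
set y := lincomb b l f' in xS.
have yk : bform M y (b k) <= 0 by apply: simple_system_le f'k.
have ky : bform M (b k) y <= 0.
  by rewrite -bform_tr; apply: (simple_system_le (simple_tr S)) f'k.
have rx : refl M (b k) x = y + (f k - sform M x (b k)) *: b k.
  by rewrite /refl {1}xS scalerBl addrA.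
set m := f k - _ in rx.
case: (lerP 0 m) => m0.
  exists (fun i => if i == k then m else f i).
    by move=> i; case: ifP.
  rewrite -(isom_lincomb _ _ _ (isom_refl k1)).
  rewrite (lincomb_split b _ (simple_uniq S) kl) eqxx.
  rewrite (_ : lincomb b l _ = y); last by apply: eq_lincomb => i _; rewrite /f' /=; case: (i == k).
  by rewrite -rx reflK.
have := bform_refl x k1; rewrite x1 rx !bformE k1.
have := Mpsd y => y0 E1.
have yy : bform M y y = 0 by nia.
have ye : y = 0 := simple_proper S kl f'k yy.
case: xk; rewrite xS ye add0r; move: x1; rewrite xS ye !bformE !bform0l !bform0r k1 /= => x1.
have -> : f k = 1 by have := f0 k; nia.
by rewrite scale1r.
Qed.

Definition sink M b l k := forall j, j \in l -> j != k -> bform M (b k) (b j) = 0.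

Lemma bform_refl_sink M b l k i j : bform M (b k) (b k) = 1 -> sink M b l k ->
  i \in l -> j \in l -> i != k -> j != k ->
  bform M (refl M (b k) (b i)) (refl M (b k) (b j)) = bform M (b i) (b j).
Proof.
move=> k1 s il jl ik jk; rewrite /refl /sform !bformE k1 !s //; ring.
Qed.

(** A reflection preserves only the symmetrized form. At a sink, E itself survives between the other
    vectors, while E(b_k, b_j) = 0 and E(b_j, b_k) are exchanged: the sink becomes a source. *)
Lemma simple_refl M b l k : simple_system M b l -> k \in l -> sink M b l k ->
  simple_system M (refl M (b k) \o b) l.
Proof.
move=> S kl s; have k1 := simple_norm S kl; have I := isom_refl k1.
split => /=; first exact: simple_uniq S.
- by move=> i il; rewrite bform_refl // (simple_norm S).
- move=> i j il jl ij; have := simple_le S il jl ij.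
  have [ik|ik] := eqVneq i k; have [jk|jk] := eqVneq j k.
  + by move: ij; rewrite ik jk eqxx.
  + move=> _; rewrite ik refl_self // /refl /sform !bformE k1 s //.
    by have := simple_le S jl kl jk; lia.
  + by move=> _; rewrite jk refl_self // /refl /sform !bformE k1 s //; lia.
  + by rewrite (bform_refl_sink k1 s).
- move=> f i il fi; rewrite -!(isom_lincomb _ _ _ I) bform_refl // => e.
  by rewrite (simple_proper S il fi e) (isom0 I).
Qed.

Lemma simple_sub M b l k : simple_system M b (rcons l k) -> simple_system M b l.
Proof.
case=> U N L P; move: U; rewrite rcons_uniq => /andP[kl U].
have sub i : i \in l -> i \in rcons l k by rewrite mem_rcons inE => ->; rewrite orbT.
split=> //.
- by move=> i /sub; apply: N.
- by move=> i j /sub il /sub jl; apply: L.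
- move=> f i il fi.
  pose g j := if j == k then 0 else f j.
  have e : lincomb b l f = lincomb b (rcons l k) g.
    rewrite /lincomb -cats1 big_cat /= big_seq1 /g eqxx scale0r addr0.
    apply: eq_big_seq => j jl; case: eqP => // jk; by rewrite -jk jl in kl.
  by rewrite e; apply: (P _ i); [exact: sub | rewrite /g fi; case: ifP].
Qed.

(** For vectors of norm one this makes E unitriangular, as on an exceptional sequence. The last
    index is a sink, the first a source. *)
Definition exceptional M b l := pairwise (fun i j => bform M (b j) (b i) == 0) l.

Lemma exceptional_sink M b l k : exceptional M b (rcons l k) -> uniq (rcons l k) -> sink M b (rcons l k) k.
Proof.
rewrite /exceptional pairwise_rcons => /andP[/allP H _] _ j.
by rewrite mem_rcons inE => /orP[/eqP->|jl]; rewrite ?eqxx // => _; apply/eqP/H.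
Qed.

Lemma exceptional_rot M b l k : simple_system M b (rcons l k) -> exceptional M b (rcons l k) ->
  exceptional M (refl M (b k) \o b) (k :: l).
Proof.
move=> S T; have U := simple_uniq S; have s := exceptional_sink T U.
have kin : k \in rcons l k by rewrite mem_rcons inE eqxx.
have k1 := simple_norm S kin.
move: T U; rewrite /exceptional pairwise_rcons rcons_uniq => /andP[_ T] /andP[kl U].
have sub i : i \in l -> i \in rcons l k by rewrite mem_rcons inE => ->; rewrite orbT.
have ne i : i \in l -> i != k by apply: contraTneq => ->.
rewrite pairwise_cons; apply/andP; split.
  apply/allP => j jl /=; rewrite refl_self // /refl /sform !bformE k1 s ?sub ?ne //.
  by apply/eqP; ring.
move: T; apply: (sub_in_pairwise (P := mem l)); last exact/allP.
move=> i j il jl /= /eqP e.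
by rewrite (bform_refl_sink k1 s) ?sub ?ne // e.
Qed.

Lemma exceptional_rev M b l : exceptional M b l -> exceptional M^T b (rev l).
Proof.
elim: l => //= i l IH; rewrite /exceptional /= rev_cons pairwise_rcons => /andP[a p].
apply/andP; split; last exact: IH.
by rewrite all_rev; apply: sub_all a => j; rewrite bform_tr.
Qed.

Definition coxeter_inv M b l x := foldl (fun x i => refl M (b i) x) x l.
Definition coxeter M b l x := foldr (fun i x => refl M (b i) x) x l.

Lemma isom_coxeter_inv M b l : (forall i, i \in l -> bform M (b i) (b i) = 1) -> isom M (coxeter_inv M b l).
Proof.
elim/last_ind: l => [|l k IH] H; first exact: isom_id.
have -> : coxeter_inv M b (rcons l k) = refl M (b k) \o coxeter_inv M b l.
  by apply: functional_extensionality_dep => x; rewrite /coxeter_inv -cats1 foldl_cat.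
apply: isom_comp; first by apply: isom_refl; apply: H; rewrite mem_rcons inE eqxx.
by apply: IH => i il; apply: H; rewrite mem_rcons inE il orbT.
Qed.

Lemma coxeter_rev M b l : coxeter M b l = coxeter_inv M b (rev l).
Proof. by apply: functional_extensionality_dep => x; rewrite /coxeter_inv foldl_rev. Qed.

Lemma isom_coxeter M b l : (forall i, i \in l -> bform M (b i) (b i) = 1) -> isom M (coxeter M b l).
Proof. by move=> H; rewrite coxeter_rev; apply: isom_coxeter_inv => i; rewrite mem_rev; apply: H. Qed.

Lemma coxeter_invK M b l : (forall i, i \in l -> bform M (b i) (b i) = 1) ->
  cancel (coxeter_inv M b l) (coxeter M b l).
Proof.
elim: l => //= i l IH H x /=.
rewrite IH; last by move=> j jl; apply: H; rewrite inE jl orbT.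
by rewrite reflK // H // inE eqxx.
Qed.

Lemma coxeter_inv_conj M s b l x : isom M s ->
  coxeter_inv M (s \o b) l (s x) = s (coxeter_inv M b l x).
Proof. by move=> si; elim: l x => //= i l IH x; rewrite (isom_refl_conj _ _ si) IH. Qed.

(** * Rotation of simple systems and Coxeter orbits *)

Section Run.
Variables (M : 'M[int]_n) (X : V -> Prop).
Hypothesis Mpsd : psd M.
Hypothesis X1 : forall x, X x -> bform M x x = 1.
(** By [in_cone_refl] a sink reflection makes only the sink itself negative, so this condition keeps
    X positive along all successive sink reflections. *)
Definition avoids_sinks := forall b l k,
  simple_system M b (rcons l k) -> exceptional M b (rcons l k) ->
  (forall x, X x -> in_cone b (rcons l k) x) -> ~ X (b k).
Hypothesis HX : avoids_sinks.

(** The indices of [ys] are reflected one by one, the last first, each moving to the front of the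
    list. Conjugation turns the product of these successive reflections into the product of the
    original ones in the opposite order, whence [coxeter_inv] for the initial [b]. *)
Lemma avoids_sinks_rotate ys xs b :
  simple_system M b (xs ++ ys) -> exceptional M b (xs ++ ys) -> (forall x, X x -> in_cone b (xs ++ ys) x) ->
  let b' := coxeter_inv M b ys \o b in
  [/\ simple_system M b' (ys ++ xs), exceptional M b' (ys ++ xs) & forall x, X x -> in_cone b' (ys ++ xs) x].
Proof.
elim/last_ind: ys xs b => [|ys k IH] xs b; first by rewrite cats0.
rewrite -rcons_cat => S T P /=.
have kin : k \in rcons (xs ++ ys) k by rewrite mem_rcons inE eqxx.
have pe : perm_eq (rcons (xs ++ ys) k) ((k :: xs) ++ ys) by rewrite perm_rcons.
have nX := HX S T P.
have S1 : simple_system M (refl M (b k) \o b) ((k :: xs) ++ ys).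
  by apply: (simple_perm pe); apply: simple_refl => //; apply: exceptional_sink (simple_uniq S).
have T1 := exceptional_rot S T.
have P1 x : X x -> in_cone (refl M (b k) \o b) ((k :: xs) ++ ys) x.
  move=> Xx; apply: (in_cone_perm pe); apply: in_cone_refl (X1 Xx) (P _ Xx) _ => //.
  by move=> xk; apply: nX; rewrite -xk.
have := IH (k :: xs) _ S1 T1 P1; rewrite cat_rcons /=.
suff -> : coxeter_inv M (refl M (b k) \o b) ys \o (refl M (b k) \o b) = coxeter_inv M b (rcons ys k) \o b by [].
apply: functional_extensionality_dep => i /=.
rewrite coxeter_inv_conj; last by apply: isom_refl; apply: simple_norm S _ kin.
by rewrite /coxeter_inv -cats1 foldl_cat.
Qed.

(** A full rotation of the list applies [coxeter_inv] to the system. Pulling back t rotations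
    restores b and moves x along its Coxeter orbit. *)
Lemma avoids_sinks_coxeter b l : simple_system M b l -> exceptional M b l -> (forall x, X x -> in_cone b l x) ->
  forall t x, X x -> in_cone b l (iter t (coxeter M b l) x).
Proof.
move=> S T P t x Xx.
have G := isom_coxeter_inv (simple_norm S).
pose b' t := iter t (coxeter_inv M b l) \o b.
have [_ _ /(_ x Xx) H] : [/\ simple_system M (b' t) l, exceptional M (b' t) l & forall x, X x -> in_cone (b' t) l x].
  elim: t => [|t [S1 T1 P1]]; first by [].
  have := avoids_sinks_rotate (xs := [::]) S1 T1 P1; rewrite cats0 /=.
  suff -> : coxeter_inv M (b' t) l \o b' t = b' t.+1 by [].
  apply: functional_extensionality_dep => i; rewrite /b' /=.
  by rewrite coxeter_inv_conj -?iterSr //; apply: isom_iter.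
case: H => f f0 ->; exists f => //; rewrite -(isom_lincomb _ _ _ (isom_iter t G)).
by elim: t => // t IH; rewrite iterSr iterS coxeter_invK //; exact: simple_norm S.
Qed.
End Run.

(** Numerical form of the Auslander-Reiten formula. By triangularity the reflections at later
    indices do not change E(-, b_j), and the reflection at the head j does not change E(b_i, -) for
    later i. *)
Lemma coxeter_form M b l : exceptional M b l -> (forall i, i \in l -> bform M (b i) (b i) = 1) ->
  forall x i, i \in l -> bform M (b i) (coxeter M b l x) = - bform M x (b i).
Proof.
have aux l' c x : (forall i, i \in l' -> bform M (b i) c = 0) ->
  bform M (coxeter M b l' x) c = bform M x c.
  elim: l' => //= j l' IH H; rewrite /refl !bformE H ?inE ?eqxx // mulr0 subr0 IH //.
  by move=> i il; apply: H; rewrite inE il orbT.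
elim: l => // j l IH; rewrite /exceptional pairwise_cons => /andP[/allP a p] N x i.
rewrite inE => /predU1P[->|il] /=.
  have -> : bform M x (b j) = bform M (coxeter M b l x) (b j).
    by rewrite aux // => k kl; apply/eqP/a.
  by rewrite /refl /sform !bformE N ?inE ?eqxx //; ring.
rewrite /refl !bformE (eqP (a _ il)) mulr0 subr0; apply: IH => //.
by move=> k kl; apply: N; rewrite inE kl orbT.
Qed.

Lemma bform_lincomb_sink M b l k f : simple_system M b (rcons l k) -> sink M b (rcons l k) k ->
  bform M (b k) (lincomb b (rcons l k) f) = f k.
Proof.
move=> S s; have kin : k \in rcons l k by rewrite mem_rcons inE eqxx.
rewrite bform_sumr (bigD1_seq k kin (simple_uniq S)) /= bformZr (simple_norm S) // mulr1.
rewrite big_seq_cond big1 ?addr0 // => i /andP[il ik].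
by rewrite bformZr s // mulr0.
Qed.

Lemma exceptional_free M b l f : simple_system M b l -> exceptional M b l ->
  (forall i, i \in l -> bform M (b i) (lincomb b l f) = 0) -> forall i, i \in l -> f i = 0.
Proof.
elim/last_ind: l => // l k IH S T H i.
have kin : k \in rcons l k by rewrite mem_rcons inE eqxx.
have fk : f k = 0 by rewrite -(bform_lincomb_sink f S (exceptional_sink T (simple_uniq S))) H.
rewrite mem_rcons inE => /predU1P[->//|il].
move: i il; apply: IH.
- exact: simple_sub S.
- by move: T; rewrite /exceptional pairwise_rcons => /andP[].
- move=> i il; have := H i; rewrite mem_rcons inE il orbT => /(_ isT).
  by rewrite /lincomb -cats1 big_cat /= big_seq1 fk scale0r addr0.
Qed.

(** E(b_k, x) is the coefficient of x at the sink, and E(x, b_k) adds to it the nonpositive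
    contributions of the other simple vectors. A member of a forbidden quadruple violates these
    inequalities against the other members. *)
Lemma in_cone_sink M b l k x : simple_system M b (rcons l k) -> exceptional M b (rcons l k) ->
  in_cone b (rcons l k) x -> 0 <= bform M (b k) x /\ bform M x (b k) <= bform M (b k) x.
Proof.
move=> S T [f f0 ->]; have s := exceptional_sink T (simple_uniq S).
have kin : k \in rcons l k by rewrite mem_rcons inE eqxx.
rewrite (bform_lincomb_sink f S s); split=> //.
rewrite (lincomb_split b f (simple_uniq S) kin) !bformE (simple_norm S kin) mulr1 gerDr.
apply: simple_system_le => //; last by rewrite eqxx.
by move=> i; case: ifP.
Qed.

Lemma in_cone_sink_drop M b l k x : simple_system M b (rcons l k) -> exceptional M b (rcons l k) ->
  in_cone b (rcons l k) x -> bform M (b k) x = 0 -> in_cone b l x.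
Proof.
move=> S T [f f0 ->]; rewrite (bform_lincomb_sink f S (exceptional_sink T (simple_uniq S))) => fk.
by exists f => //; rewrite /lincomb -cats1 big_cat /= big_seq1 fk scale0r addr0.
Qed.

End Forms.

(** * Coxeter orbits and forbidden quadruples *)

Section TameForms.
Import Order.TTheory GRing.Theory Num.Theory.
Local Open Scope ring_scope.

Variable n : nat.
Notation V := 'cV[int]_n.
Notation e := (@simple_root n).
Implicit Types (M : 'M[int]_n) (x y z c d : V) (b : 'I_n -> V) (l : seq 'I_n).

Lemma bform_simple M i j : bform M (e i) (e j) = M i j.
Proof. by rewrite /bform /simple_root trmx_delta -rowE -colE !mxE. Qed.

Lemma lincomb_simple l f : perm_eq l (enum 'I_n) -> lincomb e l f = \col_i f i.
Proof.
move=> p; rewrite (lincomb_perm _ _ p) /lincomb big_enum /=; apply/colP => i.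
rewrite summxE (bigD1 i) //= !mxE !eqxx mulr1 big1 ?addr0 // => j ji.
by rewrite !mxE eq_sym (negbTE ji) mulr0.
Qed.

Lemma lincomb_coords l x : perm_eq l (enum 'I_n) -> lincomb e l (fun i => x i 0) = x.
Proof. by move=> p; rewrite lincomb_simple //; apply/colP => i; rewrite mxE. Qed.

Definition nonneg_vec x := forall i, 0 <= x i 0.

Lemma nonneg_vec_pos l x : perm_eq l (enum 'I_n) -> nonneg_vec x <-> in_cone e l x.
Proof.
move=> p; split=> [x0|[f f0 ->] i].
  by exists (fun i => x i 0) => //; rewrite lincomb_coords.
by rewrite lincomb_simple // mxE.
Qed.

(* By Cauchy-Schwarz, |(x, e_i)| <= 2 when q(x) = 1. *)
Definition root_label M x : {ffun 'I_n -> 'I_5} := [ffun i => inord (absz (sform M x (e i) + 2))].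

Lemma root_label_radical M x y : psd M -> (forall i, M i i = 1) ->
  bform M x x = 1 -> bform M y y = 1 -> root_label M x = root_label M y -> radical M (x - y).
Proof.
move=> Mpsd Md x1 y1 /ffunP pxy.
have bd z i : bform M z z = 1 -> -2 <= sform M z (e i) <= 2.
  move=> z1; have := Mpsd (z + e i); have := Mpsd (z - e i).
  rewrite /sform !bformE z1 bform_simple Md; lia.
have exy i : sform M (x - y) (e i) = 0.
  have := bd x i x1; have := bd y i y1.
  have := pxy i; rewrite !ffunE => /(congr1 (@nat_of_ord _)) E1 h2 h1.
  move: E1; rewrite !inordK; [|lia|lia].
  have -> : sform M (x - y) (e i) = sform M x (e i) - sform M y (e i).
    by rewrite /sform !bformE; ring.
  lia.
move=> z; rewrite -(lincomb_coords z (perm_refl _)) /sform bform_sumr bform_suml -big_split big1 //= => i _.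
by have := exy i; rewrite /sform !bformZr !bformZl -mulrDr => ->; rewrite mulr0.
Qed.

(** Two iterates share one of the finitely many labels, and the isometry cancels their common
    initial segment. *)
Lemma orbit_rad M s x : psd M -> (forall i, M i i = 1) -> isom M s -> bform M x x = 1 ->
  exists2 N, (0 < N)%N & radical M (iter N s x - x).
Proof.
move=> Mpsd Md si x1.
pose f (t : 'I_(#|{ffun 'I_n -> 'I_5}|.+1)) := root_label M (iter t s x).
have /injectivePn[s1 [s2 s12 fs]] : ~~ injectiveb f.
  by apply/negP => /injectiveP /leq_card; rewrite card_ord ltnn.
have [t1 [t2 [lt12 ft]]] : exists t1 t2 : nat,
    (t1 < t2)%N /\ root_label M (iter t1 s x) = root_label M (iter t2 s x).
  case: (ltngtP s1 s2) => [lt|lt|/val_inj e12]; last by rewrite e12 eqxx in s12.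
    by exists s1, s2.
  by exists s2, s1; split=> //; apply/esym.
exists (t2 - t1)%N; first by rewrite subn_gt0.
have it t z w : sform M (iter t s z) (iter t s w) = sform M z w.
  by have [_ _ -> _] := isom_iter t si.
move=> z; rewrite -(it t1).
have [sD sZ _ _] := isom_iter t1 si.
rewrite sD -scaleN1r sZ scaleN1r -iterD subnKC; last exact: ltnW.
move: ft => /esym /root_label_radical; apply => //; by rewrite (isom_norm _ (isom_iter _ si)).
Qed.

Lemma sum_iter_shift (s : V -> V) x N :
  \sum_(t < N) iter t.+1 s x = \sum_(t < N) iter t s x + (iter N s x - x).
Proof.
elim: N => [|N IH]; first by rewrite !big_ord0 subrr addr0.
by rewrite !big_ord_recr /= IH; apply/colP => i; rewrite !mxE; ring.
Qed.

Lemma norm_neq0 M x : bform M x x = 1 -> exists i, x i 0 != 0.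
Proof.
move=> x1; apply: contrapT => H; suff x0 : x = 0 by rewrite x0 bform0l in x1.
apply/colP => i; rewrite mxE; apply/eqP; apply: contrapT => /negP xi; apply: H; by exists i.
Qed.

Lemma rad_norm M x : radical M x -> bform M x x = 0.
Proof. by move=> r; have := r x; rewrite sform_norm; lia. Qed.

(** The Coxeter orbit of x stays positive and, in an anisotropic span, is periodic. Its sum y is
    fixed, so [coxeter_form] gives q(y) = -q(y), hence y = 0. As all coefficients are nonnegative, x
    = 0, against q(x) = 1. *)
Lemma avoids_sinks_anisotropic M (X : V -> Prop) b l : psd M -> (forall i, M i i = 1) ->
  (forall x, X x -> bform M x x = 1) -> avoids_sinks M X ->
  simple_system M b l -> exceptional M b l ->
  (forall f, bform M (lincomb b l f) (lincomb b l f) = 0 -> lincomb b l f = 0) ->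
  (forall x, X x -> in_cone b l x) -> forall x, ~ X x.
Proof.
move=> Mpsd Md X1 HX S T A P x Xx.
have ci := isom_coxeter (simple_norm S); set c := coxeter M b l in ci.
have /choice[f fP] : forall t, exists f, (forall i, 0 <= f i) /\ iter t c x = lincomb b l f.
  by move=> t; have [f f0 fE] := avoids_sinks_coxeter Mpsd X1 HX S T P t Xx; exists f.
have [N N0 r] := orbit_rad Mpsd Md ci (X1 _ Xx).
have r0 : iter N c x - x = 0.
  have [_ EN] := fP N; have [_ /= E0] := fP 0%N.
  have rE : iter N c x - x = lincomb b l (fun i => f N i + - f 0%N i).
    by rewrite EN {1}E0 (lincombD _ _ _ (fun i => - f 0%N i)) lincombN.
  by move: (rad_norm r); rewrite rE; apply: A.
set y := \sum_(t < N) iter t c x.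
have cy : c y = y.
  rewrite /y (big_morph c (let: And4 h _ _ _ := ci in h) (isom0 ci)).
  by have := sum_iter_shift c x N; rewrite r0 addr0.
pose F i := \sum_(t < N) f t i.
have yE : y = lincomb b l F.
  rewrite /y /lincomb /F; under [RHS]eq_bigr do rewrite scaler_suml.
  by rewrite exchange_big /=; apply: eq_bigr => t _; case: (fP t).
have anti i : i \in l -> bform M (b i) y = - bform M y (b i).
  by move=> il; rewrite -{1}cy (coxeter_form T (simple_norm S)).
have yy : bform M y y = - bform M y y.
  rewrite {1 4}yE /lincomb bform_suml bform_sumr -sumrN; apply: eq_big_seq => i il.
  by rewrite bformZl bformZr anti // mulrN.
have y0 : y = 0 by rewrite yE; apply: A; rewrite -yE; lia.
have F0 : forall i, i \in l -> F i = 0.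
  by apply: (exceptional_free S T) => i il; rewrite -yE y0 bform0r.
have x0 : x = 0.
  have [f0 /= ->] := fP 0%N; rewrite /lincomb big_seq big1 // => i il.
  have := F0 i il; rewrite /F => /eqP; rewrite psumr_eq0; last by move=> t _; case: (fP t).
  by move=> /allP /(_ (Ordinal N0)); rewrite mem_index_enum => /(_ isT) /eqP ->; rewrite scale0r.
by have := X1 _ Xx; rewrite x0 bform0l.
Qed.

(* d is the null root, or 0 when the form is positive definite; l lists the vertices with
   sinks of E last. *)
Record tame_form M d l : Prop := TameForm {
  tame_diag : forall i, M i i = 1;
  tame_off : forall i j, i != j -> M i j <= 0;
  tame_psd : psd M;
  tame_iso : forall x, bform M x x = 0 -> exists h : int, x = h *: d;
  tame_rad : radical M d;
  tame_full : d = 0 \/ forall i, 0 < d i 0;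
  tame_perm : perm_eq l (enum 'I_n);
  tame_tri : exceptional M e l }.

Lemma tame_tr M d l : tame_form M d l -> tame_form M^T d (rev l).
Proof.
case=> D O P I R F E T; split=> //.
- by move=> i; rewrite mxE.
- by move=> i j ij; rewrite mxE O // eq_sym.
- by move=> x; rewrite bform_tr.
- by move=> x; rewrite bform_tr; apply: I.
- by move=> x; rewrite sform_tr.
- by rewrite perm_rev.
- exact: exceptional_rev.
Qed.

Lemma tame_mem M d l i : tame_form M d l -> i \in l.
Proof. by move=> H; rewrite (perm_mem (tame_perm H)) mem_enum. Qed.

Lemma proper_isotropic M d l x i : tame_form M d l -> bform M x x = 0 -> x i 0 = 0 -> x = 0.
Proof.
move=> H /(tame_iso H)[h ->]; case: (tame_full H) => [->|F]; first by rewrite scaler0.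
by rewrite mxE => /eqP; rewrite mulf_eq0 (gt_eqF (F i)) orbF => /eqP ->; rewrite scale0r.
Qed.

Lemma tame_simple M d l : tame_form M d l -> simple_system M e l.
Proof.
move=> H; split.
- by rewrite (perm_uniq (tame_perm H)) enum_uniq.
- by move=> i _; rewrite bform_simple (tame_diag H).
- by move=> i j _ _ ij; rewrite bform_simple (tame_off H).
- move=> f i _ fi f0; apply: (proper_isotropic H f0 (i := i)).
  by rewrite (lincomb_simple _ (tame_perm H)) mxE.
Qed.

Lemma bform_rad M d x : radical M d -> bform M x d = - bform M d x.
Proof. by move=> r; have := r x; rewrite /sform; lia. Qed.

(** E(d, -) is the defect. Some power of the Coxeter transformation translates x by h d; positivity
    of the forward iterates gives h >= 0, that of the backward ones h <= 0. So the orbit is finite,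
    its sum is fixed, hence radical and a multiple of d. The defect is constant along the orbit and
    therefore 0. *)
Lemma avoids_sinks_regular M d l (X : V -> Prop) : tame_form M d l -> (forall i, 0 < d i 0) ->
  (forall x, X x -> bform M x x = 1) -> avoids_sinks M X -> avoids_sinks M^T X ->
  (forall x, X x -> nonneg_vec x) -> forall x, X x -> bform M d x = 0.
Proof.
move=> H d0 X1 HX HXt Xp x Xx.
have Mpsd := tame_psd H; have Md := tame_diag H; have E := tame_perm H; have S := tame_simple H.
have T := tame_tri H; have Nl := simple_norm S.
have P y : X y -> in_cone e l y by move=> /Xp /(nonneg_vec_pos _ E).
have ci := isom_coxeter Nl; set c := coxeter M e l in ci.
have gi := isom_coxeter_inv Nl; set g := coxeter_inv M e l in gi.
have gc : cancel c g.
  move=> y; rewrite /g /c coxeter_rev -{1}(revK l) -coxeter_rev coxeter_invK // => i.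
  by rewrite mem_rev; apply: Nl.
have cpos t : nonneg_vec (iter t c x).
  by apply/(nonneg_vec_pos _ E); apply: avoids_sinks_coxeter Xx.
(* For the transposed form and the reversed list, the Coxeter transformation is the inverse [g]. *)
have gpos t : nonneg_vec (iter t g x).
  have Ht := tame_tr H; apply/(nonneg_vec_pos _ (tame_perm Ht)).
  have gE : g = coxeter M^T e (rev l).
    rewrite coxeter_rev revK; apply: functional_extensionality_dep => y; rewrite /g /coxeter_inv.
    by elim: (l) y => //= i k IH y; rewrite IH refl_tr.
  rewrite gE; apply: (@avoids_sinks_coxeter _ _ X) Xx => //.
  - exact: tame_psd Ht.
  - by move=> y /X1; rewrite bform_tr.
  - exact: tame_simple Ht.
  - exact: tame_tri Ht.
  - by move=> y /Xp /(nonneg_vec_pos _ (tame_perm Ht)).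
have [N N0 r] := orbit_rad Mpsd Md ci (X1 _ Xx).
have [h hE] := tame_iso H (rad_norm r).
have cN : iter N c x = x + h *: d by rewrite -hE addrC subrK.
have drad k : radical M (k *: d).
  by move=> z; have := tame_rad H z; rewrite /sform !bformE -mulrDr => ->; rewrite mulr0.
have fixd s k : isom M s -> s (k *: d) = k *: d by case=> _ _ _; apply.
have gN : iter N g x = x - h *: d.
  have gcN y : iter N g (iter N c y) = y.
    by elim: (N) => // k IH; rewrite iterSr iterS gc.
  have := gcN x; rewrite {1}cN.
  have [sD _ _ _] := isom_iter N gi; rewrite sD (fixd _ _ (isom_iter N gi)) => {2}<-.
  by rewrite addrK.
have itN s k : isom M s -> iter N s x = x + k *: d ->
    forall t, iter (t * N) s x = x + (t%:Z * k) *: d.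
  move=> si sN; elim=> [|t IH]; first by rewrite mul0r scale0r addr0.
  rewrite mulSn iterD IH; have [sD _ _ _] := isom_iter N si.
  rewrite sD (fixd _ _ (isom_iter N si)) sN -addrA -scalerDl; congr (_ + _ *: _); lia.
have [i _] := norm_neq0 (X1 _ Xx).
have hge s k : isom M s -> iter N s x = x + k *: d -> (forall t, nonneg_vec (iter t s x)) -> 0 <= k.
  move=> si sN sp; have := sp ((absz (x i 0%R)).+1 * N)%N i; rewrite (itN s k) // !mxE.
  move: (d0 i) (x i 0) => di xi sp0; case: (lerP 0 k) => // kn.
  have kd : k * d i 0 <= -1 by nia.
  have A0 : xi <= (absz xi)%:Z by lia.
  have A1 : (absz xi).+1%:Z = (absz xi)%:Z + 1 by lia.
  move: sp0; rewrite A1 -mulrA; move: (k * d i 0) kd (absz xi)%:Z A0 (lez_nat 0 (absz xi)) => z z1 A A0 A00.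
  by nia.
have h0 : h = 0.
  apply/eqP; rewrite eq_le (hge c h) // andbT -oppr_ge0.
  by apply: (hge g) => //; rewrite gN scaleNr.
set y := \sum_(t < N) iter t c x.
have cy : c y = y.
  rewrite /y (big_morph c (let: And4 h _ _ _ := ci in h) (isom0 ci)).
  by have := sum_iter_shift c x N; rewrite hE h0 scale0r addr0.
have cform z w : bform M z (c w) = - bform M w z.
  rewrite -(lincomb_coords z E) /lincomb bform_suml bform_sumr -sumrN.
  by apply: eq_big_seq => j jl; rewrite bformZl bformZr coxeter_form // mulrN.
have yr : radical M y by move=> z; rewrite /sform -{2}cy cform subrr.
have [k kE] := tame_iso H (rad_norm yr).
have dc t : bform M d (iter t c x) = bform M d x.
  by elim: t => //= t <-; rewrite cform (bform_rad _ (tame_rad H)) opprK.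
have : bform M d y = N%:Z * bform M d x.
  rewrite bform_sumr; under eq_bigr do rewrite dc.
  by rewrite sumr_const card_ord -mulr_natl natz.
rewrite kE bformZr (rad_norm (tame_rad H)) mulr0; nia.
Qed.

(* With p u + q w = r v in the role of an exact sequence u -> v -> w of roots. *)
Definition forbidden M u v w y := exists p q r : int,
  [/\ 0 < p, 0 < q, 0 < r & p *: u + q *: w = r *: v] /\
  [/\ bform M w u < 0, bform M v u = 0, bform M u y < 0, 0 < bform M w y & bform M y w <= 0].

Definition one_of4 u v w y x := [\/ x = u, x = v, x = w | x = y] .

(** If u, w or y is the sink, [in_cone_sink] contradicts E(u, y) < 0, E(w, u) < 0 or E(y, w) <= 0 <
    E(w, y) respectively. If v is, the relation yields q E(v, w) = r and E(u, w) < 0, so q - q E(v,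
    w)^2 = -p E(u, w) > 0 although E(v, w) is a nonzero integer. *)
Lemma forbidden_avoids M u v w y (X : V -> Prop) : forbidden M u v w y ->
  (forall x, one_of4 u v w y x -> bform M x x = 1) ->
  (forall x, one_of4 u v w y x -> X x) ->
  forall b l k, simple_system M b (rcons l k) -> exceptional M b (rcons l k) ->
  (forall x, X x -> in_cone b (rcons l k) x) -> ~ one_of4 u v w y (b k).
Proof.
move=> [p [q [r [[p0 q0 r0 rel] [wu vu uy wy yw]]]]] X1 qX b l k S T P.
have F x : one_of4 u v w y x -> 0 <= bform M (b k) x /\ bform M x (b k) <= bform M (b k) x.
  by move=> /qX /P; apply: in_cone_sink.
have Qu : one_of4 u v w y u by constructor 1.
have Qv : one_of4 u v w y v by constructor 2.
have Qw : one_of4 u v w y w by constructor 3.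
have Qy : one_of4 u v w y y by constructor 4.
have u1 := X1 _ Qu; have v1 := X1 _ Qv; have w1 := X1 _ Qw.
case=> bk; move: F; rewrite bk => F.
- by have := F _ Qy; lia.
- have E1 := congr1 (fun z => bform M z u) rel.
  have E2 := congr1 (bform M u) rel.
  have E3 := congr1 (bform M v) rel.
  have E4 := congr1 (fun z => bform M z w) rel.
  rewrite /= !bformE ?u1 ?v1 ?w1 ?vu in E1 E2 E3 E4.
  have [_ uv] := F _ Qu; rewrite vu in uv.
  have uw : bform M u w < 0 by nia.
  have vw : bform M v w != 0 by apply/eqP => vw; rewrite vw in E3; lia.
  have vw2 : 1 <= bform M v w * bform M v w by nia.
  by nia.
- by have := F _ Qu; lia.
- by have := F _ Qw; lia.
Qed.

(** The same for sources of E. If v is the source, pairing the relation with v on both sides gives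
    E(u, v) = 0, hence again E(u, w) < 0. *)
Lemma forbidden_avoids_tr M u v w y (X : V -> Prop) : forbidden M u v w y ->
  (forall x, one_of4 u v w y x -> bform M x x = 1) ->
  (forall x, one_of4 u v w y x -> X x) ->
  forall b l k, simple_system M^T b (rcons l k) -> exceptional M^T b (rcons l k) ->
  (forall x, X x -> in_cone b (rcons l k) x) -> ~ one_of4 u v w y (b k).
Proof.
move=> [p [q [r [[p0 q0 r0 rel] [wu vu uy wy yw]]]]] X1 qX b l k S T P.
have F x : one_of4 u v w y x -> 0 <= bform M x (b k) /\ bform M (b k) x <= bform M x (b k).
  by move=> /qX /P /(in_cone_sink S T); rewrite !bform_tr.
have Qu : one_of4 u v w y u by constructor 1.
have Qv : one_of4 u v w y v by constructor 2.
have Qw : one_of4 u v w y w by constructor 3.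
have Qy : one_of4 u v w y y by constructor 4.
have u1 := X1 _ Qu; have v1 := X1 _ Qv; have w1 := X1 _ Qw.
case=> bk; move: F; rewrite bk => F.
- by have := F _ Qw; lia.
- have E1 := congr1 (fun z => bform M z v) rel.
  have E2 := congr1 (bform M u) rel.
  have E3 := congr1 (bform M v) rel.
  have E4 := congr1 (fun z => bform M z w) rel.
  rewrite /= !bformE ?u1 ?v1 ?w1 ?vu in E1 E2 E3 E4.
  have [uv _] := F _ Qu; have [_ wv] := F _ Qw.
  have uv0 : bform M u v = 0 by nia.
  have vw : bform M v w != 0 by apply/eqP => vw; rewrite vw in E3; lia.
  have vw2 : 1 <= bform M v w * bform M v w by nia.
  have uw : bform M u w < 0 by rewrite uv0 in E2; nia.
  by nia.
- by have := F _ Qy; lia.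
- by have := F _ Qu; lia.
Qed.

End TameForms.

(** * Seeds *)

Section Seeds.
Import Order.TTheory GRing.Theory Num.Theory.
Local Open Scope ring_scope.

Variable n : nat.
Notation V := 'cV[int]_n.
Notation e := (@simple_root n).
Implicit Types (M : 'M[int]_n) (x y z c d : V) (b : 'I_n -> V) (l : seq 'I_n).

Lemma nonneg_vec_anti x : nonneg_vec x -> nonneg_vec (- x) -> x = 0.
Proof.
move=> x0 x1; apply/colP => i; rewrite mxE; apply/eqP.
by rewrite eq_le x0 andbT -oppr_ge0; have := x1 i; rewrite mxE.
Qed.

Lemma nonneg_vec_root M x : bform M x x = 1 -> nonneg_vec x -> ~ nonneg_vec (- x).
Proof. by move=> x1 p m; move: x1; rewrite (nonneg_vec_anti p m) bform0l. Qed.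

(** The positive and negative parts of x have disjoint supports, so their cross terms are
    nonpositive and their norms add up to at most 1. One part is then isotropic; if x has entries of
    both signs, that part also has a zero coordinate and must vanish. *)
Lemma sign_coherent M d l x : tame_form M d l -> bform M x x = 1 -> nonneg_vec x \/ nonneg_vec (- x).
Proof.
move=> H x1.
pose xp : V := \col_i Num.max 0 (x i 0); pose xm : V := \col_i Num.max 0 (- x i 0).
have xE : x = xp - xm by apply/colP => i; rewrite !mxE; lia.
have cross y z : (forall i, 0 <= y i 0) -> (forall i, 0 <= z i 0) ->
    (forall i, y i 0 = 0 \/ z i 0 = 0) -> bform M y z <= 0.
  move=> y0 z0 yz.
  rewrite -(lincomb_coords y (perm_refl _)) -(lincomb_coords z (perm_refl _)) /lincomb.
  rewrite bform_suml sumr_le0 // => i _; rewrite bform_sumr sumr_le0 // => j _.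
  rewrite bformZl bformZr bform_simple.
  have [<-|ij] := eqVneq i j; first by case: (yz i) => ->; rewrite ?mul0r ?mulr0.
  by have := tame_off H ij; have := y0 i; have := z0 j; nia.
have pm : bform M xp xm <= 0 by apply: cross => i; rewrite !mxE; lia.
have mp : bform M xm xp <= 0 by apply: cross => i; rewrite !mxE; lia.
have p0 := tame_psd H xp; have m0 := tame_psd H xm.
move: x1; rewrite {1 2}xE !bformE => x1.
case: (pselect (nonneg_vec x)) => [|np]; first by left.
case: (pselect (nonneg_vec (- x))) => [|nm]; first by right.
have [i xi] : exists i, x i 0 < 0.
  by apply: contrapT => h; apply: np => i; rewrite leNgt; apply/negP => xi; apply: h; exists i.
have [j xj] : exists j, 0 < x j 0.
  by apply: contrapT => h; apply: nm => j; rewrite mxE oppr_ge0 leNgt; apply/negP => xj; apply: h; exists j.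
have [pp|mm] : bform M xp xp = 0 \/ bform M xm xm = 0 by lia.
  have := proper_isotropic H pp (i := i); rewrite mxE => /(_ ltac:(lia)) /colP /(_ j).
  rewrite !mxE; lia.
have := proper_isotropic H mm (i := j); rewrite mxE => /(_ ltac:(lia)) /colP /(_ i).
rewrite !mxE; lia.
Qed.

Lemma quad_all (P : V -> Prop) u v w y : P u -> P v -> P w -> P y ->
  forall x, one_of4 u v w y x -> P x.
Proof. by move=> ? ? ? ? x [] ->. Qed.

(* Up to sign z becomes the sink or the source of a rotated simple_system system on which the
   quadruple is still positive; being perpendicular to z, the quadruple then lies in the
   span of the other simple_system vectors, which is anisotropic. *)
Lemma no_forbidden M d l u v w y : tame_form M d l -> forbidden M u v w y ->
  (forall x, one_of4 u v w y x -> bform M x x = 1 /\ nonneg_vec x) ->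
  ((forall i, 0 < d i 0) -> (forall x, one_of4 u v w y x -> bform M d x = 0) ->
   exists z, [/\ bform M z z = 1, bform M d z != 0 & forall x, one_of4 u v w y x -> bform M z x = 0]) ->
  False.
Proof.
move=> H cf Q Z; pose X := one_of4 u v w y.
have X1 x : X x -> bform M x x = 1 by case/Q.
have Xp x : X x -> nonneg_vec x by case/Q.
have X1t x : X x -> bform M^T x x = 1 by rewrite bform_tr; apply: X1.
have HX : avoids_sinks M X by move=> b l' k S T P; apply: (forbidden_avoids cf X1 (X := X)) S T P.
have HXt : avoids_sinks M^T X by move=> b l' k S T P; apply: (forbidden_avoids_tr cf X1 (X := X)) S T P.
have Xu : X u by constructor 1.
have Ht := tame_tr H.
have X_l x : X x -> in_cone e l x by move=> /Xp /(nonneg_vec_pos _ (tame_perm H)).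
case: (tame_full H) => [d0|d0].
  apply: (avoids_sinks_anisotropic (tame_psd H) (tame_diag H) X1 HX (tame_simple H) (tame_tri H)) Xu => // f.
  by move=> /(tame_iso H)[h]; rewrite d0 scaler0.
have Xd x : X x -> bform M d x = 0 by apply: (avoids_sinks_regular H d0 X1 HX HXt Xp).
have [z [z1 zd zX]] := Z d0 Xd.
have [{}z [{}z1 {}zd {}zX zp]] : exists z, [/\ bform M z z = 1, bform M d z != 0,
    forall x, X x -> bform M z x = 0 & nonneg_vec z].
  case: (sign_coherent H z1) => zp; first by exists z.
  exists (- z); split=> //; rewrite ?bformE ?opprK ?oppr_eq0 //.
  by move=> x /zX; rewrite bformE => ->; rewrite oppr0.
(* Since z has nonzero defect, the enlarged set cannot avoid both sinks and sources, and only z can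
   be the one met. *)
pose X' x := X x \/ x = z.
move/eqP: zd; apply; apply: (avoids_sinks_regular H d0 (X := X')); last by right.
- by move=> x [/X1|->].
- move=> b l' k S T P [Xk|kz]; first by apply: HX S T _ Xk => x Xx; apply: P; left.
  apply: (avoids_sinks_anisotropic (tame_psd H) (tame_diag H) X1 HX (simple_sub S) _ _ _ Xu).
  + by move: T; rewrite /exceptional pairwise_rcons => /andP[].
  + move=> f f0.
    have kl : k \notin l' by have := simple_uniq S; rewrite rcons_uniq => /andP[].
    pose g i := if i == k then 0 else f i.
    have E1 : lincomb b l' f = lincomb b (rcons l' k) g.
      rewrite /lincomb -cats1 big_cat /= big_seq1 /g eqxx scale0r addr0.
      by apply: eq_big_seq => i il /=; case: eqP => // ik; rewrite -ik il in kl.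
    rewrite E1; apply: (simple_proper S (i := k)); rewrite ?mem_rcons ?inE ?eqxx //.
      by rewrite /g eqxx.
    by rewrite -E1.
  + by move=> x Xx; apply: (in_cone_sink_drop S T); [apply: P; left | rewrite kz zX].
- move=> b l' k S T P [Xk|kz]; first by apply: HXt S T _ Xk => x Xx; apply: P; left.
  have s := exceptional_sink T (simple_uniq S).
  have kin : k \in rcons l' k by rewrite mem_rcons inE eqxx.
  have pe : perm_eq (rcons l' k) (k :: l') by rewrite perm_rcons.
  have nk := HXt _ _ _ S T (fun x Xx => P x (or_introl Xx)).
  (* Here z is a source of E, and E(z, -) does not read the coefficient at it. After the reflection
     -z is a sink of E, and E(-z, x) = 0 is that coefficient. *)
  have S1 := simple_refl S kin s; have T1 := exceptional_rot S T.
  set b' := refl M^T (b k) \o b in S1 T1.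
  have b'k : b' k = - z by rewrite /b' /= refl_self ?(simple_norm S) // kz.
  have S2 : simple_system M^T b' l' by apply: simple_sub S1.
  apply: (avoids_sinks_anisotropic (tame_psd Ht) (tame_diag Ht) X1t HXt S2 _ _ _ Xu).
  + by move: T1; rewrite /exceptional pairwise_cons => /andP[].
  + move=> f f0.
    have kl : k \notin l' by have := simple_uniq S; rewrite rcons_uniq => /andP[].
    pose g i := if i == k then 0 else f i.
    have E1 : lincomb b' l' f = lincomb b' (rcons l' k) g.
      rewrite /lincomb -cats1 big_cat /= big_seq1 /g eqxx scale0r addr0.
      by apply: eq_big_seq => i il /=; case: eqP => // ik; rewrite -ik il in kl.
    rewrite E1; apply: (simple_proper S1 (i := k)); rewrite // /g ?eqxx //.
    by rewrite -E1.
  + move=> x Xx.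
    have [|f f0 fE] := in_cone_refl (tame_psd Ht) S kin (X1t _ Xx) (P _ (or_introl Xx)).
      by move=> xk; apply: nk; rewrite -xk.
    exists f => //; have kx : bform M (b' k) x = 0 by rewrite b'k bformE zX ?oppr0.
    move: kx; rewrite {1}fE -/b' (lincomb_perm _ _ pe) {1}/lincomb big_cons bformDr bformZr.
    have -> : bform M (b' k) (b' k) = 1 by rewrite b'k !bformE opprK.
    rewrite bform_sumr big_seq big1 ?addr0 ?mulr1 => [fk|i il].
      by rewrite fE -/b' (lincomb_perm _ _ pe) {1}/lincomb big_cons fk scale0r add0r.
    move: T1; rewrite /exceptional pairwise_cons => /andP[/allP/(_ i il)/eqP + _].
    by rewrite bform_tr bformZr => ->; rewrite mulr0.
- by move=> x [/Xp|->].
Qed.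

(** The last field is linear independence over the rationals, stated dually as [seed_nondeg] uses
    it. *)
Record seed M (cs : 'I_n -> V) : Prop := Seed {
  seed_norm : forall j, bform M (cs j) (cs j) = 1;
  seed_sep : forall j k, nonneg_vec (cs j) -> nonneg_vec (- cs k) -> bform M (cs j) (cs k) = 0;
  seed_pos : forall j k, j != k -> nonneg_vec (cs j) -> nonneg_vec (cs k) -> bform M (cs j) (cs k) <= 0;
  seed_neg : forall j k, j != k -> nonneg_vec (- cs j) -> nonneg_vec (- cs k) -> bform M (cs j) (cs k) <= 0;
  seed_free : forall w : 'rV[int]_n, (forall j, w *m cs j = 0) -> w = 0 }.

(** This duality exchanges positive and negative c-vectors and so reduces every mutation to one at a
    positive c-vector. *)
Lemma seed_tr M cs : seed M cs -> seed M^T (fun j => - cs j).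
Proof.
case=> N S P G F; split.
- by move=> j; rewrite bform_tr !bformE opprK.
- by move=> j k pj; rewrite opprK => pk; rewrite bform_tr !bformE opprK S.
- by move=> j k jk pj pk; rewrite bform_tr !bformE opprK G // eq_sym.
- by move=> j k jk; rewrite !opprK => pj pk; rewrite bform_tr !bformE opprK P // eq_sym.
- by move=> w H; apply: F => j; apply: oppr_inj; rewrite -mulmxN H oppr0.
Qed.

Lemma bform_nondeg M d l x : tame_form M d l -> (forall z, bform M z x = 0) -> x = 0.
Proof.
move=> H x0; have E := tame_perm H.
have := exceptional_free (f := fun i => x i 0) (tame_simple H) (tame_tri H) (fun i _ => _ : _ = 0).
rewrite lincomb_coords // => f0; apply/colP => i; rewrite mxE f0 ?(tame_mem _ H) //.
Qed.

Lemma seed_nondeg M d l cs x : tame_form M d l -> seed M cs ->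
  (forall j, bform M (cs j) x = 0) -> x = 0.
Proof.
move=> H S x0; apply: (bform_nondeg H) => z.
have W : (M *m x)^T = 0.
  apply: (seed_free S) => j; apply/matrixP => a a'; rewrite !ord1 [RHS]mxE -(x0 j) /bform -mulmxA.
  transitivity (((M *m x)^T *m cs j)^T 0 0); first by rewrite [RHS]mxE.
  by rewrite trmx_mul trmxK.
by rewrite /bform -mulmxA -[M *m x]trmxK W trmx0 mulmx0 mxE.
Qed.

(* If every member of A had an arrow inside A, the sum s of A would satisfy
   q(s) <= 0; s would then be radical and pair to 0 with the whole seed. *)
Lemma seed_sink_sign M d l cs (A : {set 'I_n}) : tame_form M d l -> seed M cs -> A != finset.set0 ->
  (forall j, j \in A -> nonneg_vec (cs j)) \/ (forall j, j \in A -> nonneg_vec (- cs j)) ->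
  exists2 k, k \in A & forall j, j \in A -> j != k -> bform M (cs k) (cs j) = 0.
Proof.
move=> H S A0 sA; apply: contrapT => noS.
have le j k : j \in A -> k \in A -> j != k -> bform M (cs j) (cs k) <= 0.
  by case: sA => sA ja ka jk; [apply: (seed_pos S)|apply: (seed_neg S)] => //; apply: sA.
pose s := \sum_(j in A) cs j.
have ks k : k \in A -> bform M (cs k) s <= 0.
  move=> ka; rewrite leNgt; apply/negP => h; apply: noS; exists k => // j ja jk.
  move: h; rewrite /s bform_sumr (bigD1 k) //= (seed_norm S) (bigD1 j) /=; last by rewrite ja.
  set t := (X in 1 + (_ + X)); have t0 : t <= 0.
    by apply: sumr_le0 => i /andP[/andP[ia ik] _]; apply: le; rewrite // eq_sym.
  have := le k j ka ja; rewrite eq_sym => /(_ jk); lia.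
have ss : bform M s s = \sum_(k in A) bform M (cs k) s by rewrite {1}/s bform_suml.
have s0 : bform M s s = 0.
  by apply/eqP; rewrite eq_le (tame_psd H) andbT ss; apply: sumr_le0.
have ks0 k : k \in A -> bform M (cs k) s = 0.
  move=> ka; apply/eqP; rewrite eq_le ks //=.
  move: s0; rewrite ss (bigD1 k) //=.
  set t := (X in _ + X); have t0 : t <= 0 by apply: sumr_le0 => i /andP[ia _]; apply: ks.
  by lia.
have sr := isotropic_rad (tame_psd H) s0.
have s_0 : s = 0.
  apply: (seed_nondeg H S) => j; have [ja|ja] := boolP (j \in A); first exact: ks0.
  have jk k : k \in A -> j != k by move=> ka; apply: contraNneq ja => ->.
  have := sr (cs j); rewrite /sform.
  case: sA => sA; case: (sign_coherent H (seed_norm S j)) => pj.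
  - have : bform M s (cs j) <= 0.
      rewrite bform_suml; apply: sumr_le0 => k ka.
      by apply: (seed_pos S _ (sA k ka) pj); rewrite eq_sym; apply: jk.
    have : bform M (cs j) s <= 0.
      by rewrite bform_sumr; apply: sumr_le0 => k ka; exact: (seed_pos S (jk k ka) pj (sA k ka)).
    by lia.
  - have -> : bform M s (cs j) = 0; last by rewrite add0r.
    by rewrite bform_suml big1 // => k ka; apply: (seed_sep S (sA k ka) pj).
  - by rewrite bform_sumr big1 // => k ka; apply: (seed_sep S pj (sA k ka)).
  - have : bform M s (cs j) <= 0.
      rewrite bform_suml; apply: sumr_le0 => k ka.
      by apply: (seed_neg S _ (sA k ka) pj); rewrite eq_sym; apply: jk.
    have : bform M (cs j) s <= 0.
      by rewrite bform_sumr; apply: sumr_le0 => k ka; exact: (seed_neg S (jk k ka) pj (sA k ka)).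
    by lia.
have [k ka] := finset.set0Pn _ A0.
have [i ki] := norm_neq0 (seed_norm S k).
move/negP: ki; apply; move/colP: s_0 => /(_ i); rewrite summxE mxE => /eqP.
case: sA => sA.
  rewrite psumr_eq0 => [/allP/(_ k)|j ja]; last exact: sA.
  by rewrite mem_index_enum ka; apply.
rewrite -oppr_eq0 -sumrN psumr_eq0 => [/allP/(_ k)|j ja]; last by have := sA j ja i; rewrite mxE.
by rewrite mem_index_enum ka oppr_eq0; apply.
Qed.

(** E vanishes from positive to negative c-vectors, so a sink among the positive members, if there
    are any, is a sink of all of A. *)
Lemma seed_sink M d l cs (A : {set 'I_n}) : tame_form M d l -> seed M cs -> A != finset.set0 ->
  exists2 k, k \in A & forall j, j \in A -> j != k -> bform M (cs k) (cs j) = 0.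
Proof.
move=> H S A0; pose B := [set j in A | `[< nonneg_vec (cs j) >]].
have [B0|B0] := eqVneq B finset.set0.
  apply: (seed_sink_sign H S A0); right=> j ja.
  case: (sign_coherent H (seed_norm S j)) => // pj.
  have : j \in B by rewrite inE ja; apply/asboolP.
  by rewrite B0 inE.
have [|k kB kA] := seed_sink_sign H S B0.
  by left=> j; rewrite inE => /andP[_ /asboolP].
move: (kB); rewrite inE => /andP[ka /asboolP kp]; exists k => // j ja jk.
case: (sign_coherent H (seed_norm S j)) => pj; last exact: (seed_sep S).
by apply: kA; rewrite // inE ja; apply/asboolP.
Qed.

Lemma seed_no2cycle M d l cs i j : tame_form M d l -> seed M cs -> i != j ->
  bform M (cs i) (cs j) = 0 \/ bform M (cs j) (cs i) = 0.
Proof.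
move=> H S ij; have A0 : [set i; j] != finset.set0 by apply/finset.set0Pn; exists i; rewrite !inE eqxx.
have [k] := seed_sink H S A0; rewrite !inE => /orP[]/eqP -> K.
  by left; apply: K; rewrite ?inE ?eqxx ?orbT // eq_sym.
by right; apply: K; rewrite ?inE ?eqxx.
Qed.

(** Orthogonalization of c_j0 against A, one sink k at a time: z - E(z, c_k) c_k has norm one
    because E(c_k, z) = 0, and has the defect of z because c_k is regular. The last clause carries
    E(c_k, z) = 0 through the induction. *)
Lemma seed_perp_set M d l cs (A : {set 'I_n}) j0 : tame_form M d l -> seed M cs -> j0 \notin A ->
  (forall j, j \in A -> bform M d (cs j) = 0) -> 
  exists z, [/\ bform M z z = 1, bform M d z = bform M d (cs j0),
    forall j, j \in A -> bform M z (cs j) = 0 &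
    forall v, bform M v (cs j0) = 0 -> (forall j, j \in A -> bform M v (cs j) = 0) -> bform M v z = 0].
Proof.
move=> H S; have [m] := ubnP #|A|; elim: m A => // m IH A Am jA dA.
have A0 : j0 |: A != finset.set0 by apply/finset.set0Pn; exists j0; rewrite !inE eqxx.
have [k] := seed_sink H S A0; rewrite !inE => /predU1P[->|ka] K.
  exists (cs j0); split=> // [|j ja]; first exact: (seed_norm S).
  by apply: K; rewrite ?inE ?ja ?orbT //; apply: contraNneq jA => <-.
have [||j|z [z1 dz zA zv]] := IH (A :\ k).
- by move: Am; rewrite (cardsD1 k) ka.
- by rewrite !inE negb_and jA orbT.
- by rewrite inE => /andP[_]; apply: dA.
have kz : bform M (cs k) z = 0.
  apply: zv => [|j]; last by rewrite !inE => /andP[jk ja]; apply: K; rewrite ?inE ?ja ?orbT.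
  by apply: K; rewrite ?inE ?eqxx //; apply: contraNneq jA => ->.
exists (z - bform M z (cs k) *: cs k); split.
- by rewrite !bformE z1 kz (seed_norm S); ring.
- by rewrite !bformE dA // dz mulr0 subr0.
- move=> j ja; rewrite !bformE; have [->|jk] := eqVneq j k.
    by rewrite (seed_norm S) mulr1 subrr.
  by rewrite zA ?inE ?jk ?ja // K ?inE ?ja ?orbT // mulr0 subr0.
- move=> v v0 vA; rewrite !bformE vA // mulr0 subr0; apply: zv => // j.
  by rewrite inE => /andP[_]; apply: vA.
Qed.

(** Supplies the non-regular root that [no_forbidden] asks for. Nondegeneracy gives a c-vector of
    nonzero defect, which is orthogonalized against all regular c-vectors. *)
Lemma seed_perp M d l cs : tame_form M d l -> seed M cs -> d != 0 ->
  exists z, [/\ bform M z z = 1, bform M d z != 0 &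
    forall j, bform M d (cs j) = 0 -> bform M z (cs j) = 0].
Proof.
move=> H S dn0.
have [j0 dj0] : exists j0, bform M d (cs j0) != 0.
  apply: contrapT => h; move/eqP: dn0; apply; apply: (seed_nondeg (tame_tr H) (seed_tr S)) => j.
  rewrite bform_tr !bformE; apply/eqP; apply: contrapT => hj; apply: h; exists j.
  by apply/negP; rewrite -oppr_eq0.
pose A := [set j | bform M d (cs j) == 0].
have [||z [z1 dz zA _]] := seed_perp_set (A := A) (j0 := j0) H S.
- by rewrite inE.
- by move=> j; rewrite inE => /eqP.
by exists z; split=> // [|j dj]; [rewrite dz | apply: zA; rewrite inE dj].
Qed.

End Seeds.

(** * Invariance of seeds under mutation *)

Section Mutation.
Import Order.TTheory GRing.Theory Num.Theory.
Local Open Scope ring_scope.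

Variable n : nat.
Notation V := 'cV[int]_n.
Notation e := (@simple_root n).
Implicit Types (M : 'M[int]_n) (x y z c d : V) (b cs : 'I_n -> V) (l : seq 'I_n).

Lemma regular_perp M d l cs f k j (p q : int) : tame_form M d l -> seed M cs ->
  p != 0 -> (forall i, 0 < d i 0) ->
  bform M d (cs f) = 0 -> bform M d (cs k) = 0 -> bform M d (p *: cs j + q *: cs k) = 0 ->
  exists z, [/\ bform M z z = 1, bform M d z != 0 & [/\ bform M z (cs f) = 0,
    bform M z (cs k) = 0 & bform M z (p *: cs j + q *: cs k) = 0]].
Proof.
move=> H S p0 d0 df dk dy.
have dn0 : d != 0 by apply/eqP => d00; have := d0 k; rewrite d00 mxE ltxx.
have [z [z1 dz zP]] := seed_perp H S dn0.
exists z; split=> //; rewrite !bformE !zP ?mulr0 ?addr0 //.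
move: dy; rewrite !bformE dk mulr0 addr0 => /eqP; rewrite mulf_eq0 (negbTE p0) => /eqP //.
Qed.

(** The quadruple is -c_f, c_k, w, y, with relation -c_f + w = -E(c_f, c_k) c_k; the mutation turns
    the negative c_f into the positive w. *)
Lemma no_forbidden_flip M d l cs k f j (p q : int) y : tame_form M d l -> seed M cs ->
  p != 0 -> y = p *: cs j + q *: cs k -> let w := cs f - bform M (cs f) (cs k) *: cs k in
  nonneg_vec (cs k) -> nonneg_vec (- cs f) -> nonneg_vec w -> nonneg_vec y -> bform M y y = 1 ->
  bform M (cs k) (cs f) = 0 -> bform M (cs f) (cs k) < 0 ->
  0 < bform M (cs f) y -> 0 < bform M w y -> bform M y w <= 0 -> False.
Proof.
move=> H S p0 yE w kp fn wp yp y1 kf fk fy wy yw.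
have k1 := seed_norm S k; have f1 := seed_norm S f.
have w1 : bform M w w = 1 by rewrite /w !bformE f1 k1 kf; ring.
apply: (@no_forbidden _ M d l (- cs f) (cs k) w y H).
- exists 1, 1, (- bform M (cs f) (cs k)); split; split=> //.
  + lia.
  + by rewrite !scale1r /w addKr scaleNr.
  + by rewrite /w !bformE f1 kf; lia.
  + by rewrite bformE kf oppr0.
  + by rewrite bformE oppr_lt0.
- by apply: quad_all; split; rewrite // !bformE opprK.
- move=> d0 dX.
  have df : bform M d (cs f) = 0.
    by apply: oppr_inj; rewrite oppr0 -bformNr; apply: dX; constructor 1.
  have dk : bform M d (cs k) = 0 by apply: dX; constructor 2.
  have dy : bform M d y = 0 by apply: dX; constructor 4.
  rewrite yE in dy; have [z [z1 dz [zf zk zy]]] := regular_perp H S p0 d0 df dk dy.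
  exists z; split=> //; apply: quad_all; rewrite ?yE //; first by rewrite bformNr zf oppr0.
  by rewrite /w !bformE zf zk mulr0 subrr.
Qed.

(** The quadruple is c_k, -c_g, -w, -c_x for the transposed form, with relation -E(c_g, c_k) c_k - w
    = -c_g. *)
Lemma no_forbidden_stay M d l cs k g (x : 'I_n) : tame_form M d l -> seed M cs ->
  let w := cs g - bform M (cs g) (cs k) *: cs k in
  nonneg_vec (cs k) -> nonneg_vec (- cs g) -> nonneg_vec (- w) -> nonneg_vec (- cs x) ->
  bform M (cs k) (cs g) = 0 -> bform M (cs g) (cs k) < 0 -> 
  0 < bform M (cs x) (cs k) -> 0 < bform M (cs x) w -> bform M w (cs x) <= 0 -> False.
Proof.
move=> H S w kp gn wn xn kg gk xk xw wx.
have k1 := seed_norm S k; have g1 := seed_norm S g; have x1 := seed_norm S x.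
have w1 : bform M w w = 1 by rewrite /w !bformE g1 k1 kg; ring.
have Ht := tame_tr H; have St := seed_tr S.
apply: (@no_forbidden _ M^T d (rev l) (cs k) (- cs g) (- w) (- cs x) Ht).
- exists (- bform M (cs g) (cs k)), 1, 1; split; split=> //.
  + lia.
  + by rewrite !scale1r /w scaleNr opprB addKr.
  + by rewrite bform_tr /w !bformE k1 kg; lia.
  + by rewrite bform_tr bformE kg oppr0.
  + by rewrite bform_tr bformE oppr_lt0.
  + by rewrite bform_tr bformNl bformNr opprK.
  + by rewrite bform_tr bformNl bformNr opprK.
- by apply: quad_all; split; rewrite // bform_tr ?bformNl ?bformNr ?opprK.
- move=> d0 dX.
  have dg : bform M^T d (- cs g) = 0 by apply: dX; constructor 2.
  have dk : bform M^T d (- cs k) = 0 by rewrite bformNr dX ?oppr0 //; constructor 1.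
  have dx : bform M^T d (1 *: (- cs x) + 0 *: (- cs k)) = 0.
    by rewrite scale0r addr0 scale1r; apply: dX; constructor 4.
  have [z [z1 dz [zg zk zx]]] := regular_perp (p := 1) Ht St isT d0 dg dk dx.
  have {}zk : bform M^T z (cs k) = 0 by apply: oppr_inj; rewrite oppr0 -bformNr.
  exists z; split=> //; apply: quad_all => //.
    by rewrite /w opprB bformDr bformZr zk mulr0 zg addr0.
  by move: zx; rewrite scale0r addr0 scale1r.
Qed.

(** The c-vector mutation at a positive c_k, with b_kj = E(c_k, c_j) - E(c_j, c_k). *)
Definition mutate_vec M cs k j : V :=
  if j == k then - cs k
  else cs j + Num.max 0 (bform M (cs k) (cs j) - bform M (cs j) (cs k)) *: cs k.

(** Outside [MutFix] the vector changes as in a mutation of exceptional pairs. For j other than k,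
    only a negative c_j can change sign. *)
Inductive mut_kind M cs k j : Prop :=
| MutPos of nonneg_vec (cs j) & bform M (cs k) (cs j) <= 0 & bform M (cs j) (cs k) <= 0 &
    mutate_vec M cs k j = cs j - bform M (cs j) (cs k) *: cs k & nonneg_vec (mutate_vec M cs k j)
| MutFix of nonneg_vec (- cs j) & bform M (cs k) (cs j) = 0 & 0 <= bform M (cs j) (cs k) &
    mutate_vec M cs k j = cs j
| MutStay of nonneg_vec (- cs j) & bform M (cs k) (cs j) = 0 & bform M (cs j) (cs k) < 0 &
    mutate_vec M cs k j = cs j - bform M (cs j) (cs k) *: cs k & nonneg_vec (- mutate_vec M cs k j)
| MutFlip of nonneg_vec (- cs j) & bform M (cs k) (cs j) = 0 & bform M (cs j) (cs k) < 0 &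
    mutate_vec M cs k j = cs j - bform M (cs j) (cs k) *: cs k & nonneg_vec (mutate_vec M cs k j).

(** * Mutation at a positive c-vector *)

Section Positive.
Variables (M : 'M[int]_n) (d : V) (l : seq 'I_n) (cs : 'I_n -> V) (k : 'I_n).
Hypotheses (H : tame_form M d l) (S : seed M cs) (kp : nonneg_vec (cs k)).
Notation cs' := (mutate_vec M cs k).

Lemma mutate_vec_self : cs' k = - cs k. Proof. by rewrite /mutate_vec eqxx. Qed.

Lemma mutate_vec_norm j : bform M (cs' j) (cs' j) = 1.
Proof.
rewrite /mutate_vec; have [_|jk] := eqVneq j k; first by rewrite !bformE opprK (seed_norm S).
have k1 := seed_norm S k; have j1 := seed_norm S j.
case: (sign_coherent H j1) => jp.
  have := seed_pos S jk jp kp.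
  have kj : k != j by rewrite eq_sym.
  have := seed_pos S kj kp jp.
  case: (seed_no2cycle H S jk) => e0; rewrite e0 => h1 h2.
    rewrite (_ : Num.max _ _ = 0); last by lia.
    by rewrite scale0r addr0.
  rewrite (_ : Num.max _ _ = - bform M (cs j) (cs k)); last by lia.
  by rewrite !bformE j1 k1 e0; ring.
have kj := seed_sep S kp jp; rewrite kj.
have [jk0|jk0] := lerP 0 (bform M (cs j) (cs k)).
  rewrite (_ : Num.max _ _ = 0); last by lia.
  by rewrite scale0r addr0.
rewrite (_ : Num.max _ _ = - bform M (cs j) (cs k)); last by lia.
by rewrite !bformE j1 k1 kj; ring.
Qed.

Lemma mut_kindP j : j != k -> mut_kind M cs k j.
Proof.
move=> jk; have mE : cs' j = cs j + Num.max 0 (bform M (cs k) (cs j) - bform M (cs j) (cs k)) *: cs k.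
  by rewrite /mutate_vec (negbTE jk).
case: (sign_coherent H (seed_norm S j)) => jp.
  have a1 := seed_pos S jk jp kp.
  have a2 : bform M (cs k) (cs j) <= 0 by apply: (seed_pos S) => //; rewrite eq_sym.
  have mE' : cs' j = cs j - bform M (cs j) (cs k) *: cs k.
    rewrite mE -scaleNr; congr (_ + _ *: _).
    by case: (seed_no2cycle H S jk) => e0; lia.
  apply: MutPos => // i; rewrite mE' !mxE subr_ge0; apply: le_trans (jp i); exact: mulr_le0_ge0.
have kj := seed_sep S kp jp.
have [jk0|jk0] := lerP 0 (bform M (cs j) (cs k)).
  by apply: MutFix => //; rewrite mE (_ : Num.max _ _ = 0) ?scale0r ?addr0 //; lia.
have mE' : cs' j = cs j - bform M (cs j) (cs k) *: cs k.
  by rewrite mE -scaleNr; congr (_ + _ *: _); lia.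
by case: (sign_coherent H (mutate_vec_norm j)) => p; [apply: MutFlip | apply: MutStay].
Qed.

(** Most pairs of kinds follow by expanding E. For flip-fix, flip-stay, flip-positive and fix-stay,
    a violation produces a forbidden quadruple. *)
Lemma seed_mutate_vec : seed M cs'.
Proof.
have k1 := seed_norm S k.
have sgn j : nonneg_vec (cs' j) -> ~ nonneg_vec (- cs' j) by apply: nonneg_vec_root; apply: mutate_vec_norm.
have kneg : nonneg_vec (- cs' k) by rewrite mutate_vec_self opprK.
have kn0 j : nonneg_vec (cs' j) -> j != k by move=> jp; apply/eqP => jk; apply: (sgn j) => //; rewrite jk.
split.
- exact: mutate_vec_norm.
- move=> i j ip jn; have ik := kn0 i ip.
  have ij : i != j by apply/eqP => ij; apply: (sgn i) => //; rewrite ij.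
  case: (mut_kindP ik) => [pi ki ik0 Ei _|ni _ _ Ei|_ _ _ _ h|ni ki ik0 Ei _].
  + have [jk|jk] := eqVneq j k.
      by rewrite jk mutate_vec_self Ei !bformE k1; ring.
    case: (mut_kindP jk) => [_ _ _ _ h|nj kj jk0 Ej|nj kj jk0 Ej _|_ _ _ _ h].
    * by case: (sgn j).
    * by rewrite Ei Ej !bformE kj (seed_sep S pi nj); ring.
    * by rewrite Ei Ej !bformE kj (seed_sep S pi nj) k1; ring.
    * by case: (sgn j).
  + by case: (sgn i) => //; rewrite Ei.
  + by case: (sgn i).
  + rewrite Ei in ip.
    have [jk|jk] := eqVneq j k.
      by rewrite jk mutate_vec_self Ei !bformE k1; ring.
    case: (mut_kindP jk) => [_ _ _ _ h|nj kj jk0 Ej|nj kj jk0 Ej _|_ _ _ _ h].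
    * by case: (sgn j).
    (* As E(c_k, c_j) = 0, the claim is E(c_i, c_j) = 0; a negative value makes y = -c_j complete a
       forbidden quadruple. *)
    * rewrite Ei Ej !bformE kj mulr0 oppr0 addr0; apply/eqP; rewrite eq_le (seed_neg S) //= leNgt.
      apply/negP => fx; have xf : bform M (cs j) (cs i) = 0 by case: (seed_no2cycle H S ij) => //; lia.
      have yE : - cs j = -1 *: cs j + 0 *: cs k by rewrite scale0r addr0 scaleN1r.
      apply: (no_forbidden_flip H S _ yE kp ni ip) => //.
      - by rewrite bformNl bformNr opprK (seed_norm S).
      - by rewrite bformNr; lia.
      - by rewrite !bformE kj; lia.
      - by rewrite !bformE xf; nia.
    * rewrite Ei Ej !bformE kj k1.
      suff fg : bform M (cs i) (cs j) = 0 by rewrite fg; ring.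
      apply/eqP; rewrite eq_le (seed_neg S) //= leNgt.
      apply/negP => fx; have xf : bform M (cs j) (cs i) = 0 by case: (seed_no2cycle H S ij) => //; lia.
      (* Here y must be the negative of the mutated vector, so that E(w, y) = -E(c_i, c_j). *)
      have yE : - cs' j = -1 *: cs j + bform M (cs j) (cs k) *: cs k.
        by rewrite Ej scaleN1r opprB addrC.
      apply: (no_forbidden_flip H S _ yE kp ni ip) => //.
      - by rewrite bformNl bformNr opprK mutate_vec_norm.
      - by rewrite Ej !bformE; nia.
      - by rewrite Ej !bformE kj k1; lia.
      - by rewrite Ej !bformE xf ki k1; lia.
    * by case: (sgn j).
- move=> i j ij ip jp; have ik := kn0 i ip; have jk := kn0 j jp.
  case: (mut_kindP ik) => [pi ki ik0 Ei _|ni _ _ Ei|_ _ _ _ h|ni ki ik0 Ei _].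
  + case: (mut_kindP jk) => [pj kj jk0 Ej _|nj _ _ Ej|_ _ _ _ h|nj kj jk0 Ej _].
    * have := seed_pos S ij pi pj; rewrite Ei Ej !bformE k1; nia.
    * by case: (sgn j) => //; rewrite Ej.
    * by case: (sgn j).
    * by rewrite Ei Ej !bformE k1 kj (seed_sep S pi nj); lia.
  + by case: (sgn i) => //; rewrite Ei.
  + by case: (sgn i).
  + case: (mut_kindP jk) => [pj kj jk0 Ej _|nj _ _ Ej|_ _ _ _ h|nj kj jk0 Ej _].
    (* The mutated c_i satisfies E(w, c_k) = 0, so the violation already occurs against the
       unmutated c_j, taken as y. *)
    * rewrite leNgt; apply/negP => h; rewrite Ei Ej !bformE k1 in h; rewrite Ei in ip.
      have jf := seed_sep S pj ni.
      have yE : cs j = 1 *: cs j + 0 *: cs k by rewrite scale0r addr0 scale1r.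
      apply: (no_forbidden_flip H S _ yE kp ni ip) => //.
      - exact: seed_norm S j.
      - by nia.
      - by rewrite !bformE; lia.
      - by rewrite !bformE jf; nia.
    * by case: (sgn j) => //; rewrite Ej.
    * by case: (sgn j).
    * have := seed_neg S ij ni nj; rewrite Ei Ej !bformE k1 kj; nia.
- have nk j : nonneg_vec (- cs' j) -> j != k -> [\/ [/\ nonneg_vec (- cs j), bform M (cs k) (cs j) = 0,
      0 <= bform M (cs j) (cs k) & cs' j = cs j] |
      [/\ nonneg_vec (- cs j), bform M (cs k) (cs j) = 0, bform M (cs j) (cs k) < 0 &
      cs' j = cs j - bform M (cs j) (cs k) *: cs k]].
    move=> jn jk; case: (mut_kindP jk) => [_ _ _ _ h|nj kj jk0 Ej|nj kj jk0 Ej _|_ _ _ _ h].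
    * by case: (sgn j).
    * by constructor 1.
    * by constructor 2.
    * by case: (sgn j).
  move=> i j ij iN jN.
  have [ik|ik] := eqVneq i k.
    have jk : j != k by rewrite -ik eq_sym.
    rewrite ik mutate_vec_self.
    by case: (nk j jN jk) => -[nj kj jk0 ->]; rewrite !bformE kj ?k1; lia.
  have [jk|jk] := eqVneq j k.
    rewrite jk mutate_vec_self.
    by case: (nk i iN ik) => -[ni ki ik0 ->]; rewrite !bformE ?k1; lia.
  case: (nk i iN ik) => -[ni ki ik0 Ei]; case: (nk j jN jk) => -[nj kj jk0 Ej].
  + by rewrite Ei Ej (seed_neg S).
  + rewrite leNgt; apply/negP => h; rewrite Ei in h.
    have ji : j != i by rewrite eq_sym.
    have ij0 := seed_neg S ij ni nj; have ji0 := seed_neg S ji nj ni.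
    move: (h); rewrite Ej !bformE => h'.
    rewrite Ej in h jN.
    apply: (no_forbidden_stay H S kp nj jN ni kj jk0 _ h); first by nia.
    by rewrite !bformE ki; lia.
  + by have := seed_neg S ij ni nj; rewrite Ei Ej !bformE kj; lia.
  + by have := seed_neg S ij ni nj; rewrite Ei Ej !bformE kj k1; nia.
- move=> w w0; apply: (seed_free S) => j.
  have wk : w *m cs k = 0 by apply: oppr_inj; rewrite -mulmxN -mutate_vec_self w0 oppr0.
  have := w0 j; rewrite /mutate_vec; case: eqP => [->//|_].
  by rewrite mulmxDr -scalemxAr wk scaler0 addr0.
Qed.
End Positive.

End Mutation.

(** * c-vectors *)

Section CVectors.
Import Order.TTheory GRing.Theory Num.Theory.
Local Open Scope ring_scope.

Variable n : nat.
Notation V := 'cV[int]_n.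
Notation e := (@simple_root n).
Implicit Types (M : 'M[int]_n) (x y z c d : V) (b cs : 'I_n -> V) (l : seq 'I_n).

(* The transposed Euler form: with this convention the exchange matrix of the
   seed with c-vectors c_j has entries E(c_i, c_j) - E(c_j, c_i). *)
Definition euler (Q : quiver n) : 'M[int]_n := \matrix_(i, j) ((i == j)%:R - (Q j i)%:Z).

Definition seed_state M (X : 'M[int]_(n + n, n)) :=
  let cs j := col j (dsubmx X) in
  seed M cs /\ forall i j, usubmx X i j = bform M (cs i) (cs j) - bform M (cs j) (cs i).

(** Sign-coherence makes the entrywise signs of the mutation rule uniform along c_k, which turns it
    into a vector formula with one tropical sign s. *)
Lemma mutate_col M (X : 'M[int]_(n + n, n)) (k : 'I_n) d l : tame_form M d l -> seed_state M X ->
  let cs j := col j (dsubmx X) in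
  exists s : int, [/\ s = 1 \/ s = -1, s = 1 <-> nonneg_vec (cs k) & forall j,
    col j (dsubmx (mutate X k)) = if j == k then - cs k else
      cs j + Num.max 0 (s * (bform M (cs k) (cs j) - bform M (cs j) (cs k))) *: cs k].
Proof.
move=> H [S B] cs.
have E s j : (forall i a, Num.sg (cs k i 0) * Num.max 0 (cs k i 0 * a) = Num.max 0 (s * a) * cs k i 0) ->
    col j (dsubmx (mutate X k)) = if j == k then - cs k else
      cs j + Num.max 0 (s * (bform M (cs k) (cs j) - bform M (cs j) (cs k))) *: cs k.
  move=> h; apply/colP => i; rewrite !mxE eq_rlshift /=.
  have [->|jk] := eqVneq j k; first by rewrite !mxE.
  rewrite -B !mxE; congr (_ + _).
  by have := h i (X (lshift n k) j); rewrite /cs !mxE.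
case: (sign_coherent H (seed_norm S k)) => kp.
  exists 1; split; [by left|by split|move=> j; apply: E => i a].
  have := kp i; rewrite -/(cs k) mul1r; move: (cs k i 0) => c c0.
  by have [->|cn] := eqVneq c 0; [rewrite sgr0 mul0r mulr0 | rewrite gtr0_sg ?mul1r; nia].
exists (-1); split; [by right| |move=> j; apply: E => i a].
  by split=> // p; case: (nonneg_vec_root (seed_norm S k) p kp).
have := kp i; rewrite -/(cs k) mxE; move: (cs k i 0) => c c0.
by have [->|cn] := eqVneq c 0; [rewrite sgr0 mul0r mulr0 | rewrite ltr0_sg; nia].
Qed.

Lemma mutate_seed_state M (X : 'M[int]_(n + n, n)) (k : 'I_n) d l : tame_form M d l -> seed_state M X ->
  seed_state M (mutate X k).
Proof.
move=> H st; have [s [s1 sp E]] := mutate_col k H st; have [S B] := st.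
set cs := fun j => col j (dsubmx X) in S B E sp.
split.
  case: (sign_coherent H (seed_norm S k)) => kp.
    have s1' : s = 1 by apply/sp.
    suff -> : (fun j => col j (dsubmx (mutate X k))) = mutate_vec M cs k by apply: seed_mutate_vec H S kp.
    by apply: functional_extensionality_dep => j; rewrite E s1' mul1r.
  have s1' : s = -1 by case: s1 => // /sp p; case: (nonneg_vec_root (seed_norm S k) p kp).
  pose cs' := mutate_vec M^T (fun j => - cs j) k.
  suff -> : (fun j => col j (dsubmx (mutate X k))) = fun j => - cs' j.
    by have := seed_tr (seed_mutate_vec (tame_tr H) (seed_tr S) kp); rewrite trmxK.
  apply: functional_extensionality_dep => j; rewrite E s1' /cs' /mutate_vec; case: eqP => _; first by rewrite opprK.
  rewrite opprD -scalerN !opprK; congr (_ + _ *: _).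
  by rewrite !bform_tr !bformE; congr (Num.max _ _); ring.
move=> i j; have -> : usubmx (mutate X k) i j = let B := usubmx X in
    if (i == k) || (j == k) then - B i j
    else B i j + Num.sg (B i k) * Num.max 0 (B i k * B k j).
  by rewrite /= !mxE eq_lshift.
rewrite /= !E !B.
have [->|ik] := eqVneq i k; have [->|jk] := eqVneq j k; rewrite /= !bformE; try ring.
move: (bform M (cs k) (cs k)) (bform M (cs k) (cs i)) (bform M (cs i) (cs k))
  (bform M (cs k) (cs j)) (bform M (cs j) (cs k)) (bform M (cs i) (cs j)) (bform M (cs j) (cs i)).
move=> a ki ik' kj jk' ij ji.
pose p := ki - ik'; pose q := kj - jk'.
have -> : ik' - ki = - p by rewrite /p; ring.
rewrite -/p -/q.
have -> : ki = p + ik' by rewrite /p; ring.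
have -> : kj = q + jk' by rewrite /q; ring.
(* With p = b_ki and q = b_kj, this is the mutation rule of the exchange matrix, which holds for
   either sign s. *)
suff : Num.sg (- p) * Num.max 0 (- p * q) =
    - Num.max 0 (s * q) * p + Num.max 0 (s * p) * q by lia.
have [p0|p0|->] := ltgtP p 0; last by rewrite oppr0 sgr0 mul0r !mulr0 maxxx mul0r addr0.
  rewrite gtr0_sg ?oppr_gt0 //.
  by case: s1 => ->; case: (lerP 0 q) => q0; rewrite ?mul1r ?mulN1r; nia.
rewrite ltr0_sg ?oppr_lt0 //.
by case: s1 => ->; case: (lerP 0 q) => q0; rewrite ?mul1r ?mulN1r; nia.
Qed.

Section Quiver.
Variables (Q : quiver n) (d : V) (l : seq 'I_n).
Notation M := (euler Q).
Hypothesis H : tame_form M d l.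

Lemma initial_col j : col j (c_matrix Q [::]) = e j.
Proof. by apply/colP => i; rewrite /c_matrix /= col_mxKd !mxE eqxx andbT. Qed.

Lemma simple_root_nonneg i : nonneg_vec (e i).
Proof. by move=> j; rewrite mxE; case: (_ && _). Qed.

Lemma initial_seed : seed M e.
Proof.
have N i : bform M (e i) (e i) = 1 by rewrite bform_simple (tame_diag H).
have nn i : ~ nonneg_vec (- e i) by apply: nonneg_vec_root (N i) (@simple_root_nonneg i).
split=> //.
- by move=> j k _ /nn.
- by move=> j k jk _ _; rewrite bform_simple (tame_off H).
- by move=> j k _ /nn.
- move=> w w0; apply/rowP => j; have := w0 j.
  by rewrite /simple_root -colE => /colP /(_ 0); rewrite !mxE.
Qed.

Lemma initial_seed_state : seed_state M (seed_matrix Q [::]).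
Proof.
suff main cs : cs = e -> seed M cs /\ forall i j,
    usubmx (seed_matrix Q [::]) i j = bform M (cs i) (cs j) - bform M (cs j) (cs i).
  by apply: main; apply: functional_extensionality_dep => j; apply: initial_col.
move=> ->; split; first exact: initial_seed.
move=> i j; rewrite !bform_simple /= col_mxKu !mxE eq_sym; ring.
Qed.

Lemma seed_matrix_rcons ks k : seed_matrix Q (rcons ks k) = mutate (seed_matrix Q ks) k.
Proof. by rewrite /seed_matrix -cats1 foldl_cat. Qed.

Lemma seed_matrix_seed_state ks : seed_state M (seed_matrix Q ks).
Proof.
elim/last_ind: ks => [|ks k IH]; first exact: initial_seed_state.
by rewrite seed_matrix_rcons; apply: mutate_seed_state H IH.
Qed.

Lemma c_vectors_norm c : c_vectors Q c -> bform M c c = 1.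
Proof. by move=> [ks [j ->]]; have [S _] := seed_matrix_seed_state ks; apply: (seed_norm S). Qed.

(** * Roots reached by sink mutations *)

Section SinkMutations.
Variable (I : {set 'I_n}) (s : seq V).
Hypothesis Is : forall ks j, all (mem I) ks -> j \in I -> col j (c_matrix Q ks) \in s.

Lemma eq_in_lincomb b b' l' f : {in l', b =1 b'} -> lincomb b l' f = lincomb b' l' f.
Proof. by move=> E; apply: eq_big_seq => i il; rewrite E. Qed.

Lemma eq_in_cone b b' l' x : {in l', b =1 b'} -> in_cone b l' x -> in_cone b' l' x.
Proof. by move=> E [f f0 ->]; exists f => //; apply: eq_in_lincomb. Qed.

Lemma eq_in_simple b b' l' : {in l', b =1 b'} -> simple_system M b l' -> simple_system M b' l'.
Proof.
move=> E [U N L P]; split=> //.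
- by move=> i il; rewrite -E // N.
- by move=> i j il jl ij; rewrite -!E // L.
- by move=> f i il fi; rewrite -(eq_in_lincomb f E); apply: P fi.
Qed.

Lemma count_lt (T : eqType) (P P' : pred T) (r : seq T) (y : T) : (forall z : T, P' z -> P z) ->
  y \in r -> P y -> ~~ P' y -> (count P' r < count P r)%N.
Proof.
move=> PP yr Py nPy.
have /seq.permP E := perm_to_rem yr.
rewrite (E P) (E P') /= Py (negbTE nPy) add0n add1n ltnS.
exact: sub_count.
Qed.

(** The measure counts the positive roots of [s] in the cone of the current c-vectors. Mutating at a
    positive sink c_k removes c_k from this count and adds nothing, while x stays in the cone unless
    x = c_k. *)
Lemma sink_mutation_reach x : bform M x x = 1 -> nonneg_vec x -> in_cone e (enum I) x -> c_vectors Q x.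
Proof.
move=> x1 xp xI.
suff main m ks : (count (fun y => `[< [/\ bform M y y = 1, nonneg_vec y &
      in_cone (fun j => col j (c_matrix Q ks)) (enum I) y] >]) s < m)%N -> all (mem I) ks ->
    simple_system M (fun j => col j (c_matrix Q ks)) (enum I) ->
    in_cone (fun j => col j (c_matrix Q ks)) (enum I) x -> c_vectors Q x.
  apply: (main _ [::] (ltnSn _)) => //; last by apply: eq_in_cone xI => i _; rewrite initial_col.
  apply: (@eq_in_simple e) => [i _|]; first by rewrite initial_col.
  split; first exact: enum_uniq.
  - by move=> i _; apply: (seed_norm initial_seed).
  - by move=> i j _ _ ij; rewrite bform_simple (tame_off H).
  - move=> f i; rewrite mem_enum => iI fi f0; apply: (proper_isotropic H f0 (i := i)).
    rewrite /lincomb summxE big_enum /= (bigD1 i) //= !mxE fi mul0r add0r big1 // => j /andP[_ ji].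
    by rewrite !mxE eq_sym (negbTE ji) mulr0.
elim: m ks => // m IH ks; rewrite ltnS => sm ksI Sm Px.
set cs := fun j => col j (c_matrix Q ks) in sm Sm Px.
have [S B] := seed_matrix_seed_state ks; rewrite -/cs in S B.
pose A := [set j in I | `[< nonneg_vec (cs j) >]].
(* Otherwise all generators of the cone would be negative, and x with them. *)
have A0 : A != finset.set0.
  apply/negP => /eqP A0; apply: (nonneg_vec_root x1 xp) => i.
  case: Px => f f0 ->; rewrite /lincomb mxE summxE oppr_ge0 big_seq; apply: sumr_le0 => j.
  rewrite mem_enum => jI; rewrite mxE mulr_ge0_le0 //.
  case: (sign_coherent H (seed_norm S j)) => jp; last by have := jp i; rewrite mxE oppr_ge0.
  have : j \in A by rewrite inE jI; apply/asboolP.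
  by rewrite A0 inE.
have [k] := seed_sink H S A0; rewrite inE => /andP[kI /asboolP kp] kA.
have [xk|xk] := pselect (x = cs k); first by exists ks, k.
have sk : sink M cs (enum I) k.
  move=> j; rewrite mem_enum => jI jk; case: (sign_coherent H (seed_norm S j)) => jp.
    by apply: kA; rewrite // inE jI; apply/asboolP.
  exact: (seed_sep S).
have kin : k \in enum I by rewrite mem_enum.
have k1 := seed_norm S k.
set cs' := fun j => col j (c_matrix Q (rcons ks k)).
have E j : j \in enum I -> refl M (cs k) (cs j) = cs' j.
  move=> jI; rewrite /cs' /c_matrix seed_matrix_rcons.
  have [t [_ tp Et]] := mutate_col k H (seed_matrix_seed_state ks).
  rewrite Et; have [->|jk] := eqVneq j k; first by rewrite refl_self.
  have -> : t = 1 by apply/tp.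
  rewrite mul1r; change (refl M (cs k) (cs j) = cs j + Num.max 0
    (bform M (cs k) (cs j) - bform M (cs j) (cs k)) *: cs k).
  rewrite sk // /refl /sform sk // addr0 sub0r -scaleNr; congr (_ + _ *: _).
  by have := simple_le Sm jI kin jk; lia.
have Sm' : simple_system M cs' (enum I) by apply: eq_in_simple (simple_refl Sm kin sk).
have k' : cs' k = - cs k by rewrite -E // refl_self.
apply: (IH (rcons ks k)) => //.
- apply: leq_trans sm; apply: (@count_lt _ _ _ _ (cs k)).
  (* A positive root of the new cone is not -c_k, so reflecting back places it in the old cone. *)
  + move=> y /asboolP[y1 yp yP]; apply/asboolP; split=> //.
    have yk : y <> cs' k by rewrite k' => yk; apply: (nonneg_vec_root k1 kp); rewrite -yk.
    have := in_cone_refl (tame_psd H) Sm' kin y1 yP yk; apply: eq_in_cone => j jI /=.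
    by rewrite k' reflN -E // reflK.
  + by apply: Is.
  + apply/asboolP; split=> //; exists (fun j => (j == k)%:R) => [j|]; first by case: (j == k).
    rewrite /lincomb (bigD1_seq k) ?enum_uniq //= eqxx scale1r big1 ?addr0 // => j jk.
    by rewrite (negbTE jk) scale0r.
  (* After the mutation k is a source, so E(-, c'_k) reads the coefficient at k, which is -1 for
     c_k. *)
  + apply/asboolPn => -[_ _ [f f0 fE]].
    have {}fE : cs k = lincomb cs' (enum I) f := fE.
    have cs'1 : bform M (cs' k) (cs' k) = 1 by rewrite k' bformNl bformNr opprK k1.
    have : bform M (cs k) (cs' k) = f k.
      rewrite {1}fE bform_suml (bigD1_seq k) ?enum_uniq //= bformZl cs'1 mulr1.
      rewrite big_seq_cond big1 ?addr0 // => j /andP[jI jk]; rewrite bformZl k' -E //.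
      by rewrite /refl /sform !bformE k1 sk //; ring.
    by rewrite k' bformE k1 => fk; have := f0 k; lia.
- by rewrite all_rcons /= kI.
- by apply: eq_in_cone (in_cone_refl (tame_psd H) Sm kin x1 Px xk).
Qed.
End SinkMutations.
End Quiver.
End CVectors.

(** * The Tits form of a quiver *)

Section QuiverForms.
Import Order.TTheory GRing.Theory Num.Theory.
Local Open Scope ring_scope.

Variable n : nat.
Notation V := 'cV[int]_n.
Notation e := (@simple_root n).
Implicit Types (M : 'M[int]_n) (x y z c d : V) (l : seq 'I_n) (Q : quiver n).

Lemma bform_sum M x y : bform M x y = \sum_i \sum_j x i 0 * M i j * y j 0.
Proof.
rewrite -{1}(lincomb_coords x (perm_refl _)) -{1}(lincomb_coords y (perm_refl _)) /lincomb !big_enum /=.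
rewrite bform_suml; apply: eq_bigr => i _; rewrite bform_sumr; apply: eq_bigr => j _.
by rewrite bformZl bformZr bform_simple; ring.
Qed.

Lemma tits_form_euler Q x : tits_form Q x = bform (euler Q) x x.
Proof.
rewrite bform_sum /tits_form exchange_big -sumrB /=; apply: eq_bigr => i _.
have -> : x i 0 ^+ 2 = \sum_j (i == j)%:R * (x i 0 * x j 0).
  rewrite (bigD1 i) //= eqxx mul1r big1 ?addr0 // => j ji.
  by rewrite eq_sym (negbTE ji) mul0r.
rewrite -sumrB; apply: eq_bigr => j _.
by rewrite mxE -mulr_natr natz; ring.
Qed.

Lemma tits_bilin_euler Q x y : tits_bilin Q x y = sform (euler Q) x y.
Proof. by rewrite /tits_bilin !tits_form_euler /sform !bformE; ring. Qed.

Lemma reflection_euler Q i x : reflection Q i x = refl (euler Q) (e i) x.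
Proof. by rewrite /reflection tits_bilin_euler. Qed.

Definition mult Q (i j : 'I_n) : nat := (Q i j + Q j i)%N.

Lemma euler_diag Q i : euler Q i i = 1.
Proof. by rewrite mxE eqxx quiver_no_loop subr0. Qed.

Lemma euler_off Q i j : i != j -> euler Q i j <= 0.
Proof. by move=> ij; rewrite mxE (negbTE ij) sub0r; lia. Qed.

Lemma sform_simple Q x i :
  sform (euler Q) x (e i) = 2 * x i 0 - \sum_j (mult Q i j)%:Z * x j 0.
Proof.
rewrite -{1}(lincomb_coords x (perm_refl _)) /lincomb big_enum /sform bform_suml bform_sumr -big_split /=.
rewrite [in LHS](bigD1 i) // [in RHS](bigD1 i) //= /mult !quiver_no_loop mul0r add0r.
rewrite bformZl bformZr bform_simple euler_diag -sumrN.
congr (_ + _); first by ring.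
apply: eq_bigr => j ji; rewrite bformZl bformZr !bform_simple !mxE [i == j]eq_sym (negbTE ji) PoszD mulr0n; ring.
Qed.

(** Following arrows inside A forever repeats a vertex and closes a cycle. *)
Lemma acyclic_sink Q (A : {set 'I_n}) : acyclic Q -> A != finset.set0 ->
  exists2 k, k \in A & forall j, j \in A -> Q k j = 0%N.
Proof.
move=> HQ A0; apply: contrapT => noS.
have next (x : 'I_n) : x \in A -> exists y : 'I_n, (y \in A) && (0 < Q x y)%N.
  move=> xA; apply: contrapT => h; apply: noS; exists x => // j jA.
  by apply/eqP; rewrite -leqn0 leqNgt; apply/negP => q; apply: h; exists j; rewrite jA.
pose f (x : 'I_n) := odflt x [pick y : 'I_n in A | (0 < Q x y)%N].
have fP (x : 'I_n) : x \in A -> (f x \in A) && (0 < Q x (f x))%N.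
  by move=> /next[y yP]; rewrite /f; case: pickP => //= /(_ y); rewrite yP.
have [x0 x0A] := finset.set0Pn _ A0.
have fA t : iter t f x0 \in A by elim: t => //= t /fP /andP[].
pose g (t : 'I_(#|'I_n|.+1)) := iter t f x0.
have /injectivePn[s1 [s2 s12 fs]] : ~~ injectiveb g.
  by apply/negP => /injectiveP /leq_card; rewrite !card_ord ltnn.
have [t1 [t2 [lt12 ft]]] : exists t1 t2 : nat, (t1 < t2)%N /\ iter t1 f x0 = iter t2 f x0.
  case: (ltngtP s1 s2) => [lt|lt|/val_inj e12]; last by rewrite e12 eqxx in s12.
    by exists s1, s2.
  by exists s2, s1; split=> //; apply/esym.
pose y := iter t1 f x0; pose N := (t2 - t1).-1.
have yN : iter N f (f y) = y.
  by rewrite -iterSr prednK ?subn_gt0 // /y -iterD subnK // ltnW.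
have p m (z : 'I_n) : z \in A -> path (fun i j => 0 < Q i j)%N z (traject f (f z) m).
  by elim: m z => //= m IH z /fP /andP[fz ->]; rewrite IH.
move/negP: (HQ (y :: traject f (f y) N) isT); apply.
by rewrite /= -[X in rcons _ X]yN -trajectSr; apply: p (fA t1).
Qed.

(** Sinks of [Q] are listed first: as [euler] is transposed, they are sources of E. *)
Lemma acyclic_exceptional Q : acyclic Q ->
  exists2 l, perm_eq l (enum 'I_n) & exceptional (euler Q) e l.
Proof.
move=> HQ; suff main m (A : {set 'I_n}) : (#|A| <= m)%N ->
    exists2 l, perm_eq l (enum A) & exceptional (euler Q) e l.
  have [l pl tl] := main #|[set: 'I_n]| [set: 'I_n] (leqnn _).
  exists l => //; apply: (perm_trans pl); rewrite uniq_perm ?enum_uniq // => i.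
  by rewrite !mem_enum inE.
elim: m A => [|m IH] A.
  by rewrite leqn0 cards_eq0 => /eqP ->; exists [::] => //; rewrite enum_set0.
move=> Am; have [->|A0] := eqVneq A finset.set0; first by exists [::] => //; rewrite enum_set0.
have [k kA kS] := acyclic_sink HQ A0.
have [|l pl tl] := IH (A :\ k); first by move: Am; rewrite (cardsD1 k) kA.
have lA i : i \in l -> (i != k) && (i \in A) by rewrite (perm_mem pl) mem_enum !inE.
exists (k :: l).
  rewrite uniq_perm ?enum_uniq //=.
    rewrite (perm_uniq pl) enum_uniq andbT; apply/negP => /lA; by rewrite eqxx.
  move=> i; rewrite inE (perm_mem pl) !mem_enum !inE.
  by have [->|] := eqVneq i k; rewrite ?kA.
rewrite /exceptional pairwise_cons; apply/andP; split=> //.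
apply/allP => j /lA /andP[jk jA]; rewrite bform_simple mxE (negbTE jk) kS //.
Qed.

Lemma adjacent_transport Q (P : 'I_n -> Prop) :
  (forall i j, P i -> (0 < mult Q i j)%N -> P j) -> forall i j, P i -> P j.
Proof.
move=> step i j Pi; have /connectP[p] := quiver_connected Q i j.
elim: p i Pi => [|k p IH] i Pi /=; first by move=> _ ->.
by move=> /andP[ik kp]; apply: IH kp; apply: step ik.
Qed.

(* With x_i = w_i z_i and a_ij = mult Q i j,
   4 q(x) = sum_ij a_ij w_i w_j (z_i - z_j)^2 + 2 sum_i (2 w_i - sum_j a_ij w_j) w_i z_i^2. *)
Lemma subharmonic_tits Q (w : 'I_n -> int) : (forall i, 0 < w i) ->
  (forall i, \sum_j (mult Q i j)%:Z * w j <= 2 * w i) ->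
  psd (euler Q) /\
  forall x, bform (euler Q) x x = 0 -> forall i0, \sum_j (mult Q i0 j)%:Z * w j < 2 * w i0 -> x = 0.
Proof.
move=> w0 sub.
pose a i j : rat := (mult Q i j)%:R; pose W i : rat := (w i)%:~R.
have W0 i : 0 < W i by rewrite ltr0z.
pose s i := 2 * W i - \sum_j a i j * W j.
have sE i : s i = (2 * w i - \sum_j (mult Q i j)%:Z * w j)%:~R.
  rewrite /s rmorphB rmorphM rmorph_sum /=; congr (_ - _).
  by apply: eq_bigr => j _; rewrite rmorphM.
have s0 i : 0 <= s i by rewrite sE ler0z subr_ge0.
have aC i j : a i j = a j i by rewrite /a /mult addnC.
have a0 i j : 0 <= a i j by rewrite ler0n.
have key x : let z i : rat := (x i 0)%:~R / W i in
  4 * (bform (euler Q) x x)%:~R = \sum_i \sum_j a i j * W i * W j * (z i - z j) ^+ 2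
    + 2 * \sum_i s i * W i * z i ^+ 2.
  move=> z; have zE i : (x i 0)%:~R = W i * z i by rewrite /z mulrC divfK // gt_eqF.
  have -> : 4 * (bform (euler Q) x x)%:~R = 2 * (sform (euler Q) x x)%:~R :> rat.
    by rewrite sform_norm rmorphM /= mulrA; congr (_ * _).
  have -> : sform (euler Q) x x = \sum_i x i 0 * sform (euler Q) x (e i).
    rewrite -{2}(lincomb_coords x (perm_refl _)) /lincomb big_enum /sform bform_suml bform_sumr -big_split /=.
    by apply: eq_bigr => i _; rewrite bformZl bformZr -mulrDr.
  pose T := \sum_i \sum_j a i j * W i * W j * z i ^+ 2.
  pose U := \sum_i \sum_j a i j * (W i * z i) * (W j * z j).
  pose D := \sum_i (W i * z i) ^+ 2.
  have T' : T = \sum_i \sum_j a i j * W i * W j * z j ^+ 2.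
    rewrite /T exchange_big; apply: eq_bigr => i _; apply: eq_bigr => j _.
    by rewrite aC; ring.
  have -> : \sum_i \sum_j a i j * W i * W j * (z i - z j) ^+ 2 = T + T - 2 * U.
    rewrite {2}T' /T /U mulr_sumr -big_split -sumrB; apply: eq_bigr => i _ /=.
    by rewrite mulr_sumr -big_split -sumrB; apply: eq_bigr => j _ /=; ring.
  have -> : \sum_i s i * W i * z i ^+ 2 = 2 * D - T.
    rewrite /D /T mulr_sumr -sumrB; apply: eq_bigr => i _.
    rewrite /s mulrBl mulrBl mulr_suml mulr_suml; congr (_ - _); first by ring.
    by apply: eq_bigr => j _; ring.
  rewrite rmorph_sum /= (_ : \sum_i _ = 2 * D - U); first by ring.
  rewrite /D /U mulr_sumr -sumrB; apply: eq_bigr => i _.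
  rewrite sform_simple rmorphM rmorphB rmorphM rmorph_sum /= mulrBr zE; congr (_ - _); first by ring.
  by rewrite mulr_sumr; apply: eq_bigr => j _; rewrite rmorphM /= zE /a; ring.
have t1 x i j : let z i : rat := (x i 0)%:~R / W i in
    0 <= a i j * W i * W j * (z i - z j) ^+ 2.
  by move=> z; rewrite mulr_ge0 ?sqr_ge0 // !mulr_ge0 // ltW.
have t2 (x : V) i : let z i : rat := (x i 0)%:~R / W i in 0 <= s i * W i * z i ^+ 2.
  by move=> z; rewrite mulr_ge0 ?sqr_ge0 // mulr_ge0 // ltW.
have g1 x : let z i : rat := (x i 0)%:~R / W i in
    0 <= \sum_i \sum_j a i j * W i * W j * (z i - z j) ^+ 2.
  by move=> z; apply: sumr_ge0 => i _; apply: sumr_ge0 => j _; apply: t1.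
have g2 x : let z i : rat := (x i 0)%:~R / W i in 0 <= \sum_i s i * W i * z i ^+ 2.
  by move=> z; apply: sumr_ge0 => i _; apply: t2.
split=> [x|x x0 i0 i0s].
  rewrite -(ler0z rat) -(pmulr_rge0 _ (_ : 0 < 4)) // key.
  by rewrite addr_ge0 ?mulr_ge0 ?g1 ?g2.
have := key x; have := g1 x; have := g2 x; set z := fun i => _ / _ => /=; rewrite x0 mulr0 => h2 h1 /esym/eqP.
rewrite paddr_eq0 ?mulr_ge0 // => /andP[/eqP e1]; rewrite mulf_eq0 /= => /eqP e2.
have T2 : s i0 * W i0 * z i0 ^+ 2 = 0.
  apply/eqP; have /eqP := e2; rewrite psumr_eq0; last by move=> i _; apply: t2.
  by move=> /allP /(_ i0); rewrite mem_index_enum => /(_ isT).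
have T1 i j : a i j * W i * W j * (z i - z j) ^+ 2 = 0.
  apply/eqP; have /eqP := e1; rewrite psumr_eq0; last by move=> k _; apply: sumr_ge0 => m _; apply: t1.
  move=> /allP /(_ i); rewrite mem_index_enum => /(_ isT) /=.
  rewrite psumr_eq0; last by move=> m _; apply: t1.
  by move=> /allP /(_ j); rewrite mem_index_enum => /(_ isT).
have zx i : z i = 0 -> x i 0 = 0.
  by move/eqP; rewrite mulf_eq0 invr_eq0 (gt_eqF (W0 i)) orbF intr_eq0 => /eqP.
clearbody z; suff z0 i : z i = 0 by apply/colP => i; rewrite mxE zx.
have zi0 : z i0 = 0.
  move/eqP: T2; rewrite !mulf_eq0 (gt_eqF (W0 i0)) orbF orbb.
  by rewrite sE intr_eq0 subr_eq0 gt_eqF //= => /eqP.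
move: i0 i zi0 {i0s T2}; apply: (@adjacent_transport Q) => i j zi ij.
move/eqP: (T1 i j).
rewrite !mulf_eq0 (gt_eqF (W0 i)) (gt_eqF (W0 j)) !orbF zi sub0r oppr_eq0 orbb.
by rewrite /a pnatr_eq0 gtn_eqF //= => /eqP.
Qed.

(** At a zero of d the radical equation makes all neighbours zero, so by connectedness a single zero
    would spread everywhere. *)
Lemma nullroot_pos Q d : radical (euler Q) d -> d != 0 -> (forall i, 0 <= d i 0) ->
  forall i, 0 < d i 0.
Proof.
move=> dr dn0 d0 i; rewrite lt_def d0 andbT; apply/negP => /eqP di.
move/eqP: dn0; apply; apply/colP => j; rewrite mxE; move: i j di.
apply: (@adjacent_transport Q) => i j di ij.
have := dr (e i); rewrite sform_simple di mulr0 sub0r => /eqP; rewrite oppr_eq0.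
rewrite psumr_eq0; last by move=> k _; rewrite mulr_ge0.
move=> /allP /(_ j); rewrite mem_index_enum => /(_ isT) /=.
by rewrite mulf_eq0 => /orP[|/eqP//]; lia.
Qed.

Lemma affine_tame_form Q d : acyclic Q -> null_root Q d ->
  (forall i, 0 < d i 0) /\ exists l, tame_form (euler Q) d l.
Proof.
move=> HQ [dn0 d0 rE].
have radE x : tits_radical Q x <-> radical (euler Q) x.
  by split=> h y; have := h y; rewrite tits_bilin_euler.
have dr : radical (euler Q) d by apply/radE; rewrite rE; exists 1; rewrite scale1r.
have dp := nullroot_pos dr dn0 d0; split=> //.
have [l pl tl] := acyclic_exceptional HQ; exists l.
(* The null root itself serves as weight, with equality at every vertex. *)
have [ps _] : psd (euler Q) /\ forall x, bform (euler Q) x x = 0 -> forall i0,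
    \sum_j (mult Q i0 j)%:Z * d j 0 < 2 * d i0 0 -> x = 0.
  apply: subharmonic_tits => // i.
  by have := dr (e i); rewrite sform_simple; lia.
split=> //; [exact: euler_diag|exact: euler_off| |by right].
move=> x x0; have : tits_radical Q x by apply/radE; apply: isotropic_rad.
by rewrite rE.
Qed.

Lemma finite_tame_form Q (w : 'I_n -> int) i0 : acyclic Q -> (forall i, 0 < w i) ->
  (forall i, \sum_j (mult Q i j)%:Z * w j <= 2 * w i) ->
  \sum_j (mult Q i0 j)%:Z * w j < 2 * w i0 -> exists l, tame_form (euler Q) 0 l.
Proof.
move=> HQ w0 sub i0s; have [ps an] := subharmonic_tits w0 sub.
have [l pl tl] := acyclic_exceptional HQ; exists l.
split=> //; [exact: euler_diag|exact: euler_off| | |by left].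
- by move=> x x0; exists 0; rewrite (an x x0 i0 i0s) scaler0.
- by move=> z; rewrite /sform bform0l bform0r.
Qed.

End QuiverForms.

(** * Dynkin diagrams *)

Section Diagrams.
Import Order.TTheory GRing.Theory Num.Theory.
Local Open Scope ring_scope.

Definition neighbour_sum (w : nat -> int) (es : seq (nat * nat)) (a : nat) : int :=
  \sum_(p <- es) ((p.1 == a)%:R * w p.2 + (p.2 == a)%:R * w p.1).

Lemma neighbour_sum_rcons (w : nat -> int) es p a : neighbour_sum w (rcons es p) a =
  neighbour_sum w es a + ((p.1 == a)%:R * w p.2 + (p.2 == a)%:R * w p.1).
Proof. by rewrite /neighbour_sum -cats1 big_cat big_seq1. Qed.

(** An inequality suffices and spares locating the end points: edges leaving the first n vertices
    count only on the right. *)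
Lemma edge_mult_sum n (w : nat -> int) es a : (forall b, 0 <= w b) ->
  \sum_(b < n) (edge_mult es a b)%:Z * w b <= neighbour_sum w es a.
Proof.
move=> w0; elim: es => [|[p q] es IH].
  by rewrite /neighbour_sum big_nil big1 // => b _; rewrite mul0r.
rewrite /neighbour_sum big_cons -/(neighbour_sum w es a) /=.
have pick (c : nat) u v : (forall b : nat, u b = ((v && (c == b)))%:Z) ->
    \sum_(b < n) u b * w b <= v%:R * w c.
  move=> uE; case: (ltnP c n) => cn.
    rewrite (bigD1 (Ordinal cn)) //= uE eqxx andbT big1 ?addr0; first by rewrite natz.
    move=> b /eqP bc; rewrite uE (_ : (c == b) = false) ?andbF ?mul0r //.
    by apply/eqP => cb; apply: bc; apply: val_inj.
  rewrite big1; first by rewrite mulr_ge0.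
  move=> b _; rewrite uE (_ : (c == b) = false) ?andbF ?mul0r //.
  by apply/eqP => cb; have := ltn_ord b; lia.
rewrite (eq_bigr (fun b : 'I_n => (((p, q) == (a, b : nat)) : nat)%:Z * w b + ((p, q) == (b : nat, a) : nat)%:Z * w b
   + (edge_mult es a b)%:Z * w b)); last first.
  by move=> b _; rewrite /edge_mult /= -!mulrDl -!PoszD; congr (Posz _ * _); lia.
rewrite !big_split /= lerD // lerD //.
  by apply: (pick q (fun b => ((p, q) == (a, b) : nat)%:Z)) => b; rewrite xpair_eqE.
by apply: (pick p (fun b => ((p, q) == (b, a) : nat)%:Z)) => b; rewrite xpair_eqE andbC.
Qed.

Lemma neighbour_sum_path (w : nat -> int) k a : neighbour_sum w (path_edges k) a =
  (if (a.+1 < k)%N then w a.+1 else 0) + (if (0 < a < k)%N then w a.-1 else 0).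
Proof.
elim: k => [|[|k] IH].
- by rewrite /neighbour_sum big_nil andbF.
- rewrite /neighbour_sum big_nil /=; case: ifP; [lia|by rewrite addr0].
have -> : path_edges k.+2 = rcons (path_edges k.+1) (k, k.+1).
  rewrite /path_edges -[k.+2.-1]/k.+1 -[k.+1.-1]/k.
  by rewrite -[k.+1 in LHS]addn1 iotaD map_cat cats1.
rewrite neighbour_sum_rcons IH /=.
have [<-|ka] := eqVneq k a; last have [<-|ka'] := eqVneq k.+1 a.
- by rewrite (_ : (k.+1 == k) = false) ?mul0r ?mul1r; [do !(case: ifP => ?); lia | lia].
- by rewrite mul0r mul1r /=; do !(case: ifP => ?); lia.
- by rewrite !mul0r; do !(case: ifP => ?); lia.
Qed.

Definition subharmonic n (w : nat -> int) es := forall a, (a < n)%N -> neighbour_sum w es a <= 2 * w a.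

Lemma dynkin_weights n es : dynkin n es -> exists w : nat -> int,
  [/\ (0 < n)%N, forall a, 0 < w a, subharmonic n w es & exists2 a, (a < n)%N & neighbour_sum w es a < 2 * w a].
Proof.
case=> {n es} n nP.
- exists (fun=> 1); split=> //.
    by move=> a _; rewrite neighbour_sum_path; case: ifP; case: ifP.
  by exists 0%N => //; rewrite neighbour_sum_path /=; case: ifP.
- exists (fun a => if (a < n - 2)%N then 2 else 1); split=> //.
  + by lia.
  + by move=> a; case: ifP.
  + move=> a an; rewrite neighbour_sum_rcons neighbour_sum_path /=.
    by do !(case: ifP => ?); do 2![case: eqP => ?]; rewrite ?mul0r ?mul1r; lia.
  + exists 0%N; first by lia.
    rewrite neighbour_sum_rcons neighbour_sum_path /=.
    by do !(case: ifP => ?); do 2![case: eqP => ?]; rewrite ?mul0r ?mul1r; lia.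
(* The highest roots of E6, E7 and E8, strict at the neighbour of the extending vertex. The default
   1 of [nth] keeps the weights positive beyond the diagram. *)
- pose s : seq int := if n == 6 then [:: 1; 2; 3; 2; 1; 2]
    else if n == 7 then [:: 2; 3; 4; 3; 2; 1; 2] else [:: 2; 4; 6; 5; 4; 3; 2; 3].
  have : [|| n == 6, n == 7 | n == 8]%N by lia.
  case/or3P => /eqP nE.
  + exists (nth 1 s); rewrite /s nE /=; split; first by [].
    * by move=> [|[|[|[|[|[|a]]]]]] //=; rewrite nth_nil.
    * by move=> [|[|[|[|[|[|a]]]]]] // _; rewrite /neighbour_sum !big_cons big_nil.
    * by exists 5%N => //; rewrite ?/neighbour_sum ?big_cons ?big_nil.
  + exists (nth 1 s); rewrite /s nE /=; split; first by [].
    * by move=> [|[|[|[|[|[|[|a]]]]]]] //=; rewrite nth_nil.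
    * by move=> [|[|[|[|[|[|[|a]]]]]]] // _; rewrite /neighbour_sum !big_cons big_nil.
    * by exists 0%N => //; rewrite ?/neighbour_sum ?big_cons ?big_nil.
  + exists (nth 1 s); rewrite /s nE /=; split; first by [].
    * by move=> [|[|[|[|[|[|[|[|a]]]]]]]] //=; rewrite nth_nil.
    * by move=> [|[|[|[|[|[|[|[|a]]]]]]]] // _; rewrite /neighbour_sum !big_cons big_nil.
    * by exists 6%N => //; rewrite ?/neighbour_sum ?big_cons ?big_nil.
Qed.

End Diagrams.

(** * Roots and c-vectors *)

Section Final.
Import Order.TTheory GRing.Theory Num.Theory.
Local Open Scope ring_scope.
Local Open Scope classical_set_scope.

Lemma finite_image_label (T : Type) (F : finType) (U : choiceType) (A : set T) (f : T -> F) (g : T -> U) :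
  (forall x y, A x -> A y -> f x = f y -> g x = g y) -> finite_set [set g x | x in A].
Proof.
move=> fg; have [[x0 Ax0]|nA] := pselect (exists x, A x); last first.
  by apply: (sub_finite_set (B := set0)) => // y [x Ax _]; apply: nA; exists x.
pose h t := xget (g x0) [set y | exists x, [/\ A x, f x = t & g x = y]].
apply: (sub_finite_set (B := [set h t | t in [set: F]])); last exact/finite_image/finite_finset.
move=> _ [x Ax <-]; exists (f x) => //.
have [z [Az fz gz]] : [set y | exists z, [/\ A z, f z = f x & g z = y]] (h (f x)).
  by apply: (xgetPex (g x0)); exists (g x), x.
by rewrite /= -gz; apply: fg.
Qed.

Lemma finite_int_ubound (A : set int) : finite_set A -> has_ubound A.
Proof.
move=> /finite_seqP[s ->]; exists (\sum_(y <- s) `|y|) => x /= xs.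
by rewrite (big_rem x) //= (le_trans (ler_norm x)) // lerDl sumr_ge0.
Qed.

Lemma int_max (A : set int) x : A x -> has_ubound A -> exists b, is_max A b.
Proof.
move=> Ax [B AB]; have [m] := ubnP (absz (B - x)); elim: m x Ax => // m IH x Ax xm.
have [[y Ay xy]|ub] := pselect (exists2 y, A y & x < y).
  by apply: (IH y Ay); have := AB x Ax; have := AB y Ay; lia.
exists x; split=> // y Ay; rewrite leNgt; apply/negP => xy; apply: ub; by exists y.
Qed.

Variable n : nat.
Notation V := 'cV[int]_n.
Notation e := (@simple_root n).
Implicit Types (M : 'M[int]_n) (x y z c d : V) (l : seq 'I_n) (Q : quiver n).

Lemma finite_type_tame_form Q : acyclic Q -> finite_type Q -> exists l, tame_form (euler Q) 0 l.
Proof.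
move=> HQ [es /dynkin_weights[w [n0 w0 sub [a an sa]]] [s sE]].
have nb i : \sum_j (mult Q i j)%:Z * w (s j) <= neighbour_sum w es (s i).
  apply: le_trans (edge_mult_sum n es (s i) (fun b => ltW (w0 b))).
  rewrite [leRHS](reindex_inj (@perm_inj _ s)) /=.
  by apply: ler_sum => j _; rewrite /mult sE.
pose i0 := (s^-1)%g (Ordinal an).
apply: (@finite_tame_form n Q (fun i => w (s i)) i0) => // [i|].
  exact: le_trans (nb i) (sub _ (ltn_ord _)).
by apply: le_lt_trans (nb i0) _; rewrite /i0 permKV.
Qed.

(** * Finite roots as vectors of norm one *)

Section Roots.
Variables (Q : quiver n) (d : V) (l : seq 'I_n).
Notation M := (euler Q).
Hypothesis H : tame_form M d l.

Lemma root_label_mod x y : bform M x x = 1 -> bform M y y = 1 -> root_label M x = root_label M y ->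
  exists h : int, x = y + h *: d.
Proof.
move=> x1 y1 /(root_label_radical (tame_psd H) (tame_diag H) x1 y1) /rad_norm /(tame_iso H)[h hE].
by exists h; rewrite -hE addrC subrK.
Qed.

Lemma bform_shift x (h : int) : bform M (x + h *: d) (x + h *: d) = bform M x x.
Proof.
have := tame_rad H x; have := rad_norm (tame_rad H).
by rewrite /sform !bformE => ->; rewrite !mulr0 addr0 -addrA -mulrDr [X in _ * X]addrC => ->; rewrite mulr0 addr0.
Qed.

Lemma fin_root_norm v0 x : fin_root Q v0 x -> bform M x x = 1 /\ x v0 0 = 0.
Proof.
elim=> [i iv|i {}x iv _ [x1 xv]].
  by rewrite bform_simple (tame_diag H) mxE eq_sym (negbTE iv).
rewrite reflection_euler bform_refl ?bform_simple ?(tame_diag H) //; split=> //.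
by rewrite /refl !mxE xv eq_sym (negbTE iv) mulr0 subr0.
Qed.

Lemma fin_rootN v0 x : fin_root Q v0 x -> fin_root Q v0 (- x).
Proof.
have e1 i : bform M (e i) (e i) = 1 by rewrite bform_simple (tame_diag H).
elim=> [i iv|i {}x iv _ IH].
  by rewrite -(refl_self (e1 i)) -reflection_euler; apply: FinRootReflection iv (FinRootSimple Q iv).
rewrite reflection_euler -scaleN1r -reflZ scaleN1r -reflection_euler.
exact: FinRootReflection.
Qed.

(** Descent on the height: 2 is the sum of the x_i (x, e_i), so some term is positive, and
    reflecting at that i lowers the height while keeping x positive unless x = e_i. *)
Lemma pos_fin_root v0 x : nonneg_vec x -> bform M x x = 1 -> x v0 0 = 0 -> fin_root Q v0 x.
Proof.
have e1 i : bform M (e i) (e i) = 1 by rewrite bform_simple (tame_diag H).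
have [m] := ubnP (absz (\sum_i x i 0)); elim: m x => // m IH x xm xp x1 xv.
have [i xi] : exists i, 0 < x i 0 * sform M x (e i).
  apply: contrapT => h; have : sform M x x <= 0; last by rewrite sform_norm x1.
  rewrite -{2}(lincomb_coords x (perm_refl _)) /lincomb big_enum /sform bform_suml bform_sumr -big_split /=.
  apply: sumr_le0 => i _; rewrite bformZl bformZr -mulrDr leNgt; apply/negP => hi.
  by apply: h; exists i.
have xi0 := xp i; have s0 : 0 < sform M x (e i) by nia.
have iv : i != v0 by apply/eqP => iv; rewrite iv xv mul0r in xi.
have [->|xe] := pselect (x = e i); first exact: FinRootSimple.
have E : x = reflection Q i (refl M (e i) x) by rewrite reflection_euler reflK.
have S := tame_simple H; have pe := tame_perm H.
have rp : nonneg_vec (refl M (e i) x).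
  apply/(nonneg_vec_pos _ pe).
  have [f f0 fE] := in_cone_refl (tame_psd H) S (tame_mem i H) x1 (proj1 (nonneg_vec_pos _ pe) xp) xe.
  by exists f => //; rewrite fE -(isom_lincomb _ _ _ (isom_refl (e1 i))) reflK.
rewrite E; apply: FinRootReflection => //; apply: IH => //.
- have r0 : 0 <= \sum_j refl M (e i) x j 0 by apply: sumr_ge0.
  have x0 : 0 <= \sum_j x j 0 by apply: sumr_ge0.
  suff : \sum_j refl M (e i) x j 0 = \sum_j x j 0 - sform M x (e i) by lia.
  rewrite /refl; under eq_bigr do rewrite !mxE.
  rewrite sumrB; congr (_ - _); rewrite (bigD1 i) //= !eqxx mulr1 big1 ?addr0 // => j ji.
  by rewrite (negbTE ji) mulr0.
- by rewrite bform_refl.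
- by rewrite /refl !mxE xv eq_sym (negbTE iv) mulr0 subr0.
Qed.

Lemma fin_rootP v0 x : fin_root Q v0 x <-> bform M x x = 1 /\ x v0 0 = 0.
Proof.
split=> [|[x1 xv]]; first exact: fin_root_norm.
case: (sign_coherent H x1) => xp; first exact: pos_fin_root.
rewrite -[x]opprK; apply/fin_rootN/pos_fin_root => //.
  by rewrite !bformE opprK.
by rewrite mxE xv oppr0.
Qed.

(** Lets mutations inside I play the role of the full subquiver on I, later the complement of the
    extending vertex. *)
Lemma c_matrix_support (I : {set 'I_n}) i ks j : i \notin I -> all (mem I) ks -> j \in I ->
  c_matrix Q ks i j = 0.
Proof.
move=> iI; elim/last_ind: ks j => [|ks k IH] j.
  by move=> _ jI; rewrite /c_matrix /= col_mxKd mxE; case: eqP => // ij; rewrite ij jI in iI.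
rewrite all_rcons => /andP[kI ksI] jI; rewrite /c_matrix seed_matrix_rcons !mxE eq_rlshift /=.
have C0 j' : j' \in I -> seed_matrix Q ks (rshift n i) j' = 0.
  by move=> jI'; rewrite -(IH _ ksI jI') !mxE.
by rewrite !C0 // sgr0 mul0r oppr0 addr0 if_same.
Qed.

Lemma finite_c_vectors_reach (I : {set 'I_n}) x :
  finite_set [set c | c_vectors Q c /\ forall i, i \notin I -> c i 0 = 0] ->
  bform M x x = 1 -> nonneg_vec x -> (forall i, i \notin I -> x i 0 = 0) -> c_vectors Q x.
Proof.
move=> /finite_seqP[s sE] x1 xp xI; apply: (sink_mutation_reach H (I := I) (s := s) _ x1 xp).
  move=> ks j ksI jI; have : [set` s] (col j (c_matrix Q ks)).
    rewrite -sE; split; first by exists ks, j.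
    by move=> i iI; rewrite mxE (c_matrix_support iI).
  by [].
exists (fun i => x i 0) => //; rewrite -[LHS](lincomb_coords x (perm_refl _)) /lincomb !big_enum /=.
rewrite (bigID (mem I)) /= [X in _ + X]big1 ?addr0 // => i iI.
by rewrite xI // scale0r.
Qed.

End Roots.

Lemma finite_type_c_vectors Q : acyclic Q -> finite_type Q -> finite_set (c_vectors Q).
Proof.
move=> HQ /(finite_type_tame_form HQ)[l H].
rewrite -[c_vectors Q]image_id; apply: (finite_image_label (f := root_label (euler Q))) => x y cx cy.
move=> /(root_label_mod H (c_vectors_norm H cx) (c_vectors_norm H cy))[h ->].
by rewrite scaler0 addr0.
Qed.

(** * Coordinate differences in affine type *)

Section Affine.
Variables (Q : quiver n) (d : V) (l : seq 'I_n).
Notation M := (euler Q).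
Hypotheses (H : tame_form M d l) (d0 : forall i, 0 < d i 0).

Lemma affine_diffs_finite v w : d v 0 = d w 0 -> finite_set (coord_diffs (c_vectors Q) v w).
Proof.
move=> dvw; apply: (finite_image_label (f := root_label M)) => x y cx cy.
move=> /(root_label_mod H (c_vectors_norm H cx) (c_vectors_norm H cy))[h ->].
by rewrite !mxE dvw; congr `|_|; ring.
Qed.

(** If d_v and d_w differ, a bound on c_v - c_w leaves finitely many c-vectors in each class modulo
    d. There are then finitely many in all, so every positive root is a c-vector, including e_v + m
    d for large m. *)
Lemma affine_diffs_bounded v w : has_ubound (coord_diffs (c_vectors Q) v w) -> d v 0 = d w 0.
Proof.
move=> [B hB]; apply: contrapT => dvw.
have bd c : c_vectors Q c -> `|c v 0 - c w 0| <= B by move=> cc; apply: hB; exists c.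
have F : finite_set (c_vectors Q).
  (* Shifted by B, the difference c_v - c_w lies between 0 and 2B. *)
  pose f c : {ffun 'I_n -> 'I_5} * 'I_((absz B).*2.+1) :=
    (root_label M c, inord (absz (c v 0 - c w 0 + B))).
  rewrite -[c_vectors Q]image_id; apply: (finite_image_label (f := f)) => x y cx cy [+ /(congr1 val)].
  have bx := bd _ cx; have by_ := bd _ cy.
  move=> /(root_label_mod H (c_vectors_norm H cx) (c_vectors_norm H cy))[h xE].
  rewrite /= !inordK; try lia.
  move=> E; have {}E : x v 0 - x w 0 = y v 0 - y w 0 by lia.
  move: E; rewrite xE !mxE => E; have : h * (d v 0 - d w 0) = 0 by move: E => /eqP; rewrite -subr_eq0 => /eqP <-; ring.
  by move/eqP; rewrite mulf_eq0 subr_eq0 => /orP[/eqP ->|/eqP//]; rewrite scale0r addr0.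
have [B' BE] : exists B' : nat, `|B| = B'%:Z by exists (absz B); lia.
(* As v and w are distinct, the difference here has absolute value at least |B| + 1. *)
pose x := e v + (B'.+2)%:Z *: d.
have cx : c_vectors Q x.
  apply: (finite_c_vectors_reach H (I := [set: 'I_n])).
  - by apply: sub_finite_set F => c [].
  - by rewrite (bform_shift H) bform_simple (tame_diag H).
  - by move=> i; rewrite !mxE addr_ge0 ?mulr_ge0 ?(ltW (d0 i)) //; case: (_ && _).
  - by move=> i; rewrite inE.
have := bd _ cx; rewrite !mxE !eqxx /=.
have [//|vw] := eqVneq w v; first by move=> wv; case: dvw; rewrite wv.
by case: (ltgtP (d v 0) (d w 0)) => // ?; nia.
Qed.

(** Since d is 1 at v0, subtracting c_v0 d turns a c-vector into a finite root with the same
    difference. Conversely, c-vectors vanishing at v0 are determined by their class modulo d, hence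
    finitely many, so every positive finite root is a c-vector; absolute values take care of the
    negative ones. *)
Lemma affine_diffs_fin_root v w v0 : d v 0 = d w 0 -> d v0 0 = 1 ->
  coord_diffs (c_vectors Q) v w = coord_diffs (fin_root Q v0) v w.
Proof.
move=> dvw dv0; rewrite eqEsubset; split=> _ [x xP <-].
  exists (x + (- x v0 0) *: d); last by rewrite !mxE dvw; congr `|_|; ring.
  by apply/(fin_rootP H); rewrite (bform_shift H) (c_vectors_norm H xP) !mxE dv0; split=> //; ring.
have [x1 xv] := fin_root_norm H xP.
have F : finite_set [set c | c_vectors Q c /\ forall i, i \notin (~: [set v0])%SET -> c i 0 = 0].
  rewrite -[X in finite_set X]image_id; apply: (finite_image_label (f := root_label M)) => y z [cy y0] [cz z0].
  move=> /(root_label_mod H (c_vectors_norm H cy) (c_vectors_norm H cz))[h yE].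
  have v0I : v0 \notin (~: [set v0])%SET by rewrite !inE eqxx.
  have := y0 v0 v0I; rewrite {1}yE !mxE (z0 v0 v0I) dv0 yE => h0.
  by rewrite (_ : h = 0) ?scale0r ?addr0 //; lia.
have supp y : y v0 0 = 0 -> forall i, i \notin (~: [set v0])%SET -> y i 0 = 0.
  by move=> yv i; rewrite !inE negbK => /eqP ->.
case: (sign_coherent H x1) => xp.
  by exists x => //; apply: (finite_c_vectors_reach H F) => //; apply: supp.
exists (- x); last by rewrite !mxE -opprD normrN.
apply: (finite_c_vectors_reach H F) => //; first by rewrite !bformE opprK.
by apply: supp; rewrite mxE xv oppr0.
Qed.
End Affine.
End Final.

Theorem theorem1p1 (n : nat) (Q : quiver n) (HQ : acyclic Q) :
  (finite_type Q ->
     finite_set (c_vectors Q) /\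
     forall v w : 'I_n, has_ubound (coord_diffs (c_vectors Q) v w)) /\
  (affine_type Q ->
     forall d : 'cV[int]_n, null_root Q d ->
     forall v w : 'I_n,
       (has_ubound (coord_diffs (c_vectors Q) v w) <->
        d v ord0 = d w ord0) /\
       (d v ord0 = d w ord0 ->
        forall v0 : 'I_n, d v0 ord0 = 1%R ->
        exists b : int,
          isLub (coord_diffs (c_vectors Q) v w) b /\
          is_max (coord_diffs (fin_root Q v0) v w) b)).
Proof.
split=> [fQ|_ d dQ v w].
  have F := finite_type_c_vectors HQ fQ; split=> // v w.
  exact/finite_int_ubound/finite_image.
have [d0 [l H]] := affine_tame_form HQ dQ.
have bounded : d v ord0 = d w ord0 -> has_ubound (coord_diffs (c_vectors Q) v w).
  by move=> dvw; apply/finite_int_ubound/(affine_diffs_finite H).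
split; first by split=> //; apply: affine_diffs_bounded H d0 _ _.
move=> dvw v0 dv0; rewrite -(affine_diffs_fin_root H dvw dv0).
pose c := col v (c_matrix Q [::]).
have [||b bm] := @int_max (coord_diffs (c_vectors Q) v w) `|c v ord0 - c w ord0|%R.
- by exists c => //; exists [::], v.
- exact: bounded.
by exists b; split=> //; case: bm => Ab ub; split=> // b' ub'; exact: (ub' _ Ab).
Qed.
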